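(* Let $d \geq 2$ be an integer and let $\Omega \subset \mathbf{R}^{d}$ be a bounded region (with non-empty interior) with $D := \operatorname{diam} \Omega < \infty$. Let $\{x_{i}\}_{i=1}^{N} \subset \Omega$ be a set of pairwise distinct points, and let $\mu_{N} = \frac{1}{N} \sum_{j=1}^{N} \delta_{x_{j}}$. Then, for any $t$ with $t \geq D^{2}/d$ and any $a$ with $a \geq \sqrt{d}/(2D)$, we have $$ \frac{1}{N^{2}} \sum_{i \neq j} \exp \left( -a^{2} \| x_{i} - x_{j} \|^{2} \right) \leq \frac{2(4\pi)^{d/2}D^{d-2}}{d^{d/2-1}} \left( - \frac{1}{N^{2}} \sum_{i \neq j} G_{d}(x_{i}, x_{j}) + A_{d}(t, \mu_{N}) - \frac{C_{d}(t)}{N} - \frac{1}{(4\pi)^{d/2}} \frac{N-1}{N} h_{d,D}(t) \right), $$ where $G_{d}$, $A_{d}(t,\mu_{N})$, $C_{d}(t)$ and $h_{d,D}(t)$ are as defined in the context.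
   Context: $\|\cdot\|$ is the Euclidean norm on $\mathbf{R}^{d}$, and $\sum_{i \neq j}$ denotes the sum over all ordered pairs $(i,j)$ with $1 \leq i,j \leq N$, $i \neq j$. $G_{d}$ is the $d$-dimensional fundamental solution for the Laplacian $\varDelta$ on $\mathbf{R}^{d}$, given by the expression $$ G_{2}(x,y) = \frac{1}{2\pi} \log \| x - y \| \quad (d=2), \qquad G_{d}(x,y) = - \frac{1}{2(d-2) s_{d}} \frac{1}{\| x - y \|^{d-2}} \quad (d \geq 3), $$ where $s_{d}$ is the surface area of the $(d-1)$-dimensional unit sphere $\{x \in \mathbf{R}^{d} : \|x\|=1\}$; it is stated to satisfy $\varDelta_{x} G_{d}(x,y) = \delta_{y}(x)$. For $t>0$ and $b \in \mathbf{R}^{d}$, $\mathrm{e}^{t\varDelta}\delta_{b}$ denotes the heat kernel $$ \mathrm{e}^{t \varDelta_{y}} \delta_{b}(y) = \frac{1}{(4\pi t)^{d/2}} \exp \left( -\frac{\| y - b \|^{2}}{4t} \right), $$ and $\mathrm{e}^{t\varDelta}\mu_{N} := \frac{1}{N}\sum_{j=1}^{N} \mathrm{e}^{t\varDelta}\delta_{x_{j}}$. For $t>0$, $$ A_{d}(t, \mu_{N}) := \int_{\mathbf{R}^{d}} \mathrm{d}x \int_{\mathbf{R}^{d}} \mathrm{d}y \; G_{d}(x,y) \, \mathrm{e}^{\frac{t}{2} \varDelta_{x}} \mu_{N}(x) \, \mathrm{e}^{\frac{t}{2} \varDelta_{y}} \mu_{N}(y), \qquad C_{d}(t) := \int_{\mathbf{R}^{d}}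 \mathrm{d}y \; G_{d}(0,y) \, \mathrm{e}^{t \varDelta_{y}} \delta_{0}(y). $$ Finally, $$ h_{d,D}(t) := \begin{cases} \dfrac{\mathrm{e}^{-d/4}}{1-d/2} \left( \dfrac{1}{t^{d/2-1}} - \dfrac{d^{d/2-1}}{D^{d-2}} \right) & (d \neq 2), \\[10pt] \mathrm{e}^{-1/2} \log \left( \dfrac{2t}{D^{2}} \right) & (d = 2). \end{cases} $$
   Formalization: For d ≥ 3, G_d is taken as −1/((d−2)s_d)·‖x−y‖^{2−d}, the constant for which ΔG_d = δ; the printed extra factor 2 in the denominator contradicts this and makes the inequality false (d=4, N=2, ‖x₁−x₂‖=D=2, a=1/2, t large). *)

(* Defs.v *)
From HB Require Import structures.
From mathcomp Require Import all_boot all_order all_algebra.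
From mathcomp Require Import all_classical all_reals all_analysis.

Set Implicit Arguments.
Unset Strict Implicit.
Unset Printing Implicit Defensive.

Import Order.TTheory GRing.Theory Num.Theory.
Import numFieldNormedType.Exports.

Local Open Scope classical_set_scope.
Local Open Scope ring_scope.

Definition rV_display : measure_display.
Proof. exact: default_measure_display. Qed.

(* Points of R^n are row vectors 'rV[R]_n, measurable for the product
   sigma-algebra, i.e. the one generated by the coordinate maps. *)
Section measurable_rV.
Context {R : realType} (n : nat).

Let coord : 'I_n -> 'rV[R]_n -> measurableTypeR R := fun i v => v 0 i.

Let rV_set0 : g_sigma_preimage coord set0.
Proof. exact: sigma_algebra0. Qed.

Let rV_setC A : g_sigma_preimage coord A -> g_sigma_preimage coord (~` A).
Proof. exact: sigma_algebraC. Qed.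

Let rV_bigcup (F : (set 'rV[R]_n)^nat) :
  (forall i, g_sigma_preimage coord (F i)) ->
  g_sigma_preimage coord (\bigcup_i (F i)).
Proof. exact: sigma_algebra_bigcup. Qed.

HB.instance Definition _ := @isMeasurable.Build rV_display 'rV[R]_n
  (g_sigma_preimage coord) rV_set0 rV_setC rV_bigcup.

End measurable_rV.

Lemma measurable_rV_coord {R : realType} n (i : 'I_n) :
  measurable_fun [set: 'rV[R]_n]
    (fun v : 'rV[R]_n => v 0 i : measurableTypeR R).
Proof.
move=> _ Y mY; rewrite setTI; apply: sub_sigma_algebra => /=.
rewrite -bigcup_seq/=; exists i => /=; first by rewrite mem_index_enum.
by exists Y => //; rewrite setTI.
Qed.

Lemma measurable_fun_rVP {R : realType} n d (T : measurableType d)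
    (f : T -> 'rV[R]_n) :
  (forall i, measurable_fun [set: T] (fun x => f x 0 i : measurableTypeR R)) ->
  measurable_fun [set: T] f.
Proof.
move=> mf _ A mA; rewrite setTI.
suff : <<s \big[setU/set0]_(i < n) preimage_set_system [set: 'rV[R]_n]
    (fun v : 'rV[R]_n => v 0 i : measurableTypeR R) measurable >>
    `<=` [set B | measurable (f @^-1` B)] by apply.
apply: smallest_sub.
  split => [|B|F]/=; first by rewrite preimage_set0.
    by rewrite setTD preimage_setC => /measurableC.
  by rewrite preimage_bigcup => h; exact: bigcupT_measurable.
move=> B; rewrite -bigcup_seq => -[i _ [C mC <-]] /=.
by rewrite setTI -[X in measurable X]setTI; exact: mf.
Qed.

Definition rV_cons {R : realType} n (p : measurableTypeR R * 'rV[R]_n) :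
  'rV[R]_n.+1 :=
  \row_(i < n.+1) if unlift ord0 i is Some j then p.2 0 j else p.1.

Lemma measurable_rV_cons {R : realType} n :
  measurable_fun setT (@rV_cons R n).
Proof.
apply: measurable_fun_rVP => i; rewrite /rV_cons.
under eq_fun do rewrite mxE.
case: unliftP => [j|] _; last exact: measurable_fst.
exact: (measurableT_comp (measurable_rV_coord j) measurable_snd).
Qed.

Fixpoint lebesgue_rV {R : realType} n : set 'rV[R]_n -> \bar R :=
  match n with
  | 0 => \d_(0 : 'rV[R]_0)
  | m.+1 => pushforward (lebesgue_measure \x @lebesgue_rV R m)%E (@rV_cons R m)
  end.

Arguments lebesgue_rV {R} n _.

Section lebesgue_rV_measure.
Context {R : realType}.

Let rV_uncons n (v : 'rV[R]_n.+1) : measurableTypeR R * 'rV[R]_n :=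
  (v 0 ord0, \row_j v 0 (lift ord0 j)).

Let rV_consK n : cancel (@rV_cons R n) (@rV_uncons n).
Proof.
move=> [x v]; rewrite /rV_uncons /rV_cons mxE unlift_none /=; congr pair.
by apply/rowP => j; rewrite !mxE liftK.
Qed.

Let measurable_rV_uncons n : measurable_fun setT (@rV_uncons n).
Proof.
apply: measurable_fun_pair; first exact: measurable_rV_coord.
apply: measurable_fun_rVP => i; under eq_fun do rewrite mxE.
exact: measurable_rV_coord.
Qed.

Let lebesgue_rVP n : exists mu : {sigma_finite_measure set 'rV[R]_n -> \bar R},
  mu = @lebesgue_rV R n :> (set 'rV[R]_n -> \bar R).
Proof.
elim: n => [|n [mu muE]] /=; first by exists (\d_(0 : 'rV[R]_0)).
rewrite -muE.
pose nu := pushforward (lebesgue_measure \x mu)%E (@rV_cons R n).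
pose nuM : {measure set 'rV[R]_n.+1 -> \bar R} :=
  measure_function_pushforward__canonical__measure_function_Measure
    (lebesgue_measure \x mu)%E (@measurable_rV_cons R n).
have nuS : sigma_finite setT nuM.
  have /sigma_finiteP[F [FT ndF Foo]] := sigma_finiteT (@lebesgue_measure R).
  have /sigma_finiteP[G [GT ndG Goo]] := sigma_finiteT mu.
  exists (fun k => @rV_uncons n @^-1` (F k `*` G k)).
    rewrite -preimage_bigcup (_ : \bigcup_k _ = setT) ?preimage_setT//.
    rewrite -setXTT FT GT; apply/seteqP; split => -[u v] /=.
      by move=> [k _ [Fu Gv]]; split; exists k.
    move=> [[k _ Fku] [l _ Glv]]; exists (maxn k l) => //; split.
    - by move: u Fku; exact/subsetPset/ndF/leq_maxl.
    - by move: v Glv; exact/subsetPset/ndG/leq_maxr.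
  move=> k; have [mF Fk] := Foo k; have [mG Gk] := Goo k; split.
    rewrite -[X in measurable X]setTI.
    by apply: measurable_rV_uncons => //; exact: measurableX.
  rewrite /nuM/= /pushforward (_ : _ @^-1` _ = F k `*` G k).
    by rewrite product_measure1E// lte_mul_pinfty// ge0_fin_numE.
  by apply/funext => p; exact: (congr1 (F k `*` G k) (rV_consK p)).
pose i := Measure_isSigmaFinite.Build _ _ _ nuM nuS.
pose nuF := HB.pack_for {sigma_finite_measure set 'rV[R]_n.+1 -> \bar R} nu i.
by exists (nuF (@measurable_rV_cons R n)).
Qed.

Context (n : nat).

Let lebesgue_rV0 : @lebesgue_rV R n set0 = 0%E.
Proof. by have [mu <-] := lebesgue_rVP n; exact: measure0. Qed.

Let lebesgue_rV_ge0 A : (0 <= @lebesgue_rV R n A)%E.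
Proof. by have [mu <-] := lebesgue_rVP n; exact: measure_ge0. Qed.

Let lebesgue_rV_sigma_additive : semi_sigma_additive (@lebesgue_rV R n).
Proof.
by have [mu <-] := lebesgue_rVP n; exact: measure_semi_sigma_additive.
Qed.

HB.instance Definition _ := isMeasure.Build _ _ _ (@lebesgue_rV R n)
  lebesgue_rV0 lebesgue_rV_ge0 lebesgue_rV_sigma_additive.

Let lebesgue_rV_sigma_finite : sigma_finite setT (@lebesgue_rV R n).
Proof. by have [mu <-] := lebesgue_rVP n; exact: sigma_finiteT. Qed.

HB.instance Definition _ := Measure_isSigmaFinite.Build _ _ _
  (@lebesgue_rV R n) lebesgue_rV_sigma_finite.

End lebesgue_rV_measure.

Section definitions.
Context {R : realType} (d : nat).
Implicit Types (x y b : 'rV[R]_d) (A : set 'rV[R]_d) (t : R).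

(* The norm carried by 'rV[R]_d in the library is the sup norm. *)
Definition enorm x : R := Num.sqrt (\sum_(i < d) x 0 i ^+ 2).

Definition diam A : R := sup [set enorm (p.1 - p.2) | p in A `*` A].

(* (d-1)-dimensional area as the codimension-one Minkowski content: the limit
   as e tends to 0 of the volume of the e-tube around A divided by 2e.  On a compact
   smooth hypersurface this is the surface area. *)
Definition tube A (e : R) : set 'rV[R]_d :=
  [set y | exists2 x, A x & enorm (y - x) < e].

Definition surface_area A : R :=
  lim (fine (lebesgue_rV d (tube A e)) / (2 * e) @[e --> 0^'+]).

Definition s_d : R := surface_area [set x | enorm x = 1].

(* The coefficient for d >= 3 is the one for which the Laplacian of
   fund_sol(., y) is the Dirac mass at y.  The value 1 / (2 (d - 2) s_d) also
   found in print is off by a factor 2; with it the main inequality fails (d = 4,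
   N = 2, two points at distance D, a = sqrt d / (2 D), t large).
   On the diagonal fund_sol takes the junk value 0. *)
Definition fund_sol x y : R :=
  if d == 2%N then (2 * pi)^-1 * ln (enorm (x - y))
  else - ((d - 2)%:R * s_d)^-1 * (enorm (x - y) ^+ (d - 2))^-1.

Definition heat_kernel t b y : R :=
  ((4 * pi * t) `^ (d%:R / 2))^-1 * expR (- (enorm (y - b) ^+ 2 / (4 * t))).

(* e^{t Laplacian} mu_N, where mu_N is the empirical measure of x_1, .., x_N *)
Definition heat_empirical N (x : 'I_N -> 'rV[R]_d) t y : R :=
  N%:R^-1 * \sum_(j < N) heat_kernel t (x j) y.

Definition A_d N (x : 'I_N -> 'rV[R]_d) t : R :=
  \int[lebesgue_rV d]_u \int[lebesgue_rV d]_v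
    (fund_sol u v * heat_empirical x (t / 2) u * heat_empirical x (t / 2) v).

Definition C_d t : R := \int[lebesgue_rV d]_y (fund_sol 0 y * heat_kernel t 0 y).

Definition h_dD (D t : R) : R :=
  if d == 2%N then expR (- 2^-1) * ln (2 * t / D ^+ 2)
  else expR (- (d%:R / 4)) / (1 - d%:R / 2) *
       ((t `^ (d%:R / 2 - 1))^-1 - d%:R `^ (d%:R / 2 - 1) / D ^+ (d - 2)).

End definitions.

(* Main.v *)
Require Import Defs.
From HB Require Import structures.
From mathcomp Require Import all_boot all_order all_algebra.
From mathcomp Require Import all_classical all_reals all_analysis.
From mathcomp Require Import measurable_realfun ring lra.

Set Implicit Arguments.
Unset Strict Implicit.
Unset Printing Implicit Defensive.

Import Order.TTheory GRing.Theory Num.Theory.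
Import numFieldNormedType.Exports.

Local Open Scope classical_set_scope.
Local Open Scope ring_scope.

(** Write p_s for the heat kernel at time s, a function of the squared distance
q, and G for the fundamental solution.  Everything rests on one representation
of G as a superposition of heat kernels: with a constant k,
<<
  G(z) = k + \int_(s > 0) (1_(s >= 1) p_s(0) - p_s(z)) ds.
>>
In dimension at least 3 one has G = - \int p_s ds; in the plane that integral
diverges for large s, and subtracting p_s(0) from s = 1 on repairs this at the
cost of a constant, so all dimensions are treated alike.  The integrand is
[defect], and [Psi0E] is the formula.

- Convolving with p_t replaces p_s by p_(s+t) (semigroup property) and leaves
  the constants alone, so G * p_t = Psi_t, where Psi_t is the same integral with
  p_(s+t) in place of p_s ([Psi_conv]).  Hence C_d(t) = Psi_t(0) and A_d(t) is
  the mean of Psi_t(x_i - x_j) over all pairs ([C_dE], [A_dE]): the diagonal of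
  A_d is cancelled by C_d / N, and the claim becomes an inequality for each
  pair of distinct points.
- By construction Psi_t - G is the integral of p_s - p_(s+t) over s > 0, that is
  the integral of p_s over 0 < s < t; only the lower bound [Psi_growth] matters.
- Put T = D^2 / d.  A point at squared distance q <= D^2 = d T sees p_s at least
  as large as p_T for T/2 <= s <= T ([hk_ge_half]), and p_s at least as large as
  (4 pi s)^(-d/2) e^(-d/4) for s >= T.  The second range contributes exactly
  h_(d,D)(t), the first at least (T/2) p_T, and the prefactor of the theorem
  turns (T/2) p_T into exp(- d q / (4 D^2)), which dominates exp(- a^2 q)
  ([gaussian_le_Psi_growth]).

The representation of G is proved by differentiating in the distance r.  The
derivative of - p_s is (r / 2s) p_s, whose integral over s is a multiple of
r^(1-d) by scaling ([flux_scale]); the derivative of G is r^(1-d) / s_d.  So it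
remains to identify the factor, [flux], with 1 / s_d.  The area s_d, a Minkowski
content, is d times the volume of the unit ball ([s_dE]); writing the Gaussian,
which has mass 1, as a mixture of indicators of balls relates that volume to
[flux] ([ball_vol_flux]). *)

(** * Integration over R^n *)

Section affine_change.
Context {R : realType}.
Local Notation leb := (@lebesgue_measure R).
Variables (k b : R) (k0 : 0 < k).

Let aff (x : measurableTypeR R) : measurableTypeR R := k * x + b.

Let maff : measurable_fun [set: measurableTypeR R] aff.
Proof.
by apply: measurable_funD => //; apply: measurable_funM.
Qed.

Let push : {measure set (measurableTypeR R) -> \bar R} :=
  measure_function_pushforward__canonical__measure_function_Measure leb maff.

Let knn : {nonneg R} := NngNum (ltW k0).

Let lebE A : measurable A -> leb A = mscale knn push A.
Proof.
move=> mA; apply: lebesgue_measure_unique => // _ [[u v]] _ <-.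
change (leb `]u, v]%classic = k%:E * leb (aff @^-1` `]u, v]%classic))%E.
rewrite (_ : aff @^-1` _ = `](u - b) / k, (v - b) / k]%classic); last first.
  apply/seteqP; split=> x /=; rewrite !in_itv/= /aff;
    by rewrite ltr_pdivrMr // ler_pdivlMr // ltrBlDr lerBrDr mulrC.
rewrite !lebesgue_measure_itv/= !lte_fin ltr_pM2r ?invr_gt0// ltrD2r.
case: ifPn => _; last by rewrite mule0.
by rewrite -!EFinD -EFinM; congr EFin; field; rewrite gt_eqF.
Qed.

(** Lebesgue measure is the only measure giving intervals their length, and an
affine image of it, rescaled by the slope, does so too.  This one lemma supplies both the scaling and the
translation of integrals. *)
Lemma ge0_integral_affine (f : R -> \bar R) :
  measurable_fun [set: R] f -> (forall x, (0 <= f x)%E) ->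
  (\int[leb]_x f x = k%:E * \int[leb]_x f (k * x + b)%R)%E.
Proof.
move=> mf f0.
rewrite (eq_measure_integral (mscale knn push)); last first.
  by move=> A mA _; exact: lebE.
rewrite ge0_integral_mscale//; congr (_ * _)%E.
have := @ge0_integral_pushforward _ _ _ _ _ _ maff leb setT f measurableT mf.
by rewrite preimage_setT; apply=> y _; exact: f0.
Qed.

End affine_change.

Section lebesgue_rV_theory.
Context {R : realType}.
Local Notation leb := (@lebesgue_measure R).

Lemma ge0_integral_rV0 (f : 'rV[R]_0 -> \bar R) :
  measurable_fun setT f -> (\int[lebesgue_rV 0]_v f v = f 0%R)%E.
Proof.
move=> mf; change (\int[\d_(0%R : 'rV[R]_0)]_v f v = f 0%R)%E.
by rewrite integral_dirac// diracT mul1e.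
Qed.

Lemma ge0_integral_rVS n (f : 'rV[R]_n.+1 -> \bar R) :
  measurable_fun setT f -> (forall v, (0 <= f v)%E) ->
  (\int[lebesgue_rV n.+1]_v f v =
   \int[leb]_x \int[lebesgue_rV n]_w f (rV_cons (x, w)))%E.
Proof.
move=> mf f0.
change (\int[pushforward (leb \x @lebesgue_rV R n)%E (@rV_cons R n)]_v f v = 
   \int[leb]_x \int[lebesgue_rV n]_w f (rV_cons (x, w)))%E.
rewrite (@ge0_integral_pushforward _ _ _ _ _ _ (@measurable_rV_cons R n))//.
rewrite preimage_setT fubini_tonelli1//.
by apply: measurableT_comp => //; exact: measurable_rV_cons.
by move=> x; exact: f0.
Qed.

Lemma measurable_rV_proj n (i : 'I_n) :
  measurable_fun [set: 'rV[R]_n] (fun v : 'rV[R]_n => v 0 i : R).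
Proof. exact: measurable_rV_coord. Qed.

(** Induction on the dimension: the measure on R^(n+1) is by construction the
product of the one on R and the one on R^n. *)
Lemma integral_rV_prod n (f : 'I_n -> R -> R) (I : 'I_n -> R) :
  (forall i, measurable_fun [set: R] (f i)) ->
  (forall i x, 0 <= f i x) ->
  (forall i, \int[leb]_x (f i x)%:E = (I i)%:E)%E ->
  (\int[lebesgue_rV n]_v (\prod_(i < n) f i (v ord0 i))%:E =
   (\prod_(i < n) I i)%:E)%E.
Proof.
elim: n f I => [|n IHn] f I mf f0 fI.
  rewrite ge0_integral_rV0; first by rewrite !big_ord0.
  by apply/measurable_EFinP; apply: measurable_prod => -[].
rewrite ge0_integral_rVS; last 2 first.
- apply/measurable_EFinP; apply: measurable_prod => i _.
  by apply: measurableT_comp => //; exact: measurable_rV_proj.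
- by move=> v; rewrite lee_fin prodr_ge0.
under eq_integral => x _.
  under eq_integral => w _.
    rewrite big_ord_recl.
    rewrite (_ : rV_cons (x, w) ord0 ord0 = x); last first.
      by rewrite mxE unlift_none.
    under eq_bigr => i _.
      rewrite (_ : rV_cons (x, w) ord0 (lift ord0 i) = w 0 i); last first.
        by rewrite mxE liftK.
      over.
    rewrite EFinM; over.
  rewrite ge0_integralZl//; last 3 first.
  - apply/measurable_EFinP; apply: measurable_prod => i _.
    by apply: measurableT_comp => //; exact: measurable_rV_proj.
  - by move=> w _; rewrite lee_fin prodr_ge0.
  - by rewrite lee_fin.
  rewrite (IHn (fun i => f (lift ord0 i)) (fun i => I (lift ord0 i)))//.
  over.
rewrite /= ge0_integralZr//; last 3 first.
- by apply/measurable_EFinP; exact: mf.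
- by move=> x _; rewrite lee_fin.
- rewrite lee_fin prodr_ge0// => i _.
  by rewrite -lee_fin -fI integral_ge0// => x _; rewrite lee_fin.
by rewrite fI big_ord_recl EFinM.
Qed.

End lebesgue_rV_theory.

Definition sqn {R : realType} n (v : 'rV[R]_n) : R := \sum_(i < n) v 0 i ^+ 2.

Section sqn_theory.
Context {R : realType}.

Lemma sqn_ge0 n (v : 'rV[R]_n) : 0 <= sqn v.
Proof. by apply: sumr_ge0 => i _; rewrite sqr_ge0. Qed.

Lemma sqr_enorm n (v : 'rV[R]_n) : enorm v ^+ 2 = sqn v.
Proof. by rewrite sqr_sqrtr// sqn_ge0. Qed.

Lemma enorm_ge0 n (v : 'rV[R]_n) : 0 <= enorm v.
Proof. exact: sqrtr_ge0. Qed.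

Lemma sqnN n (v : 'rV[R]_n) : sqn (- v) = sqn v.
Proof. by apply: eq_bigr => i _; rewrite mxE sqrrN. Qed.

Lemma sqn0 n : sqn (0 : 'rV[R]_n) = 0.
Proof. by rewrite /sqn big1// => i _; rewrite mxE expr0n. Qed.

Lemma sqn_eq0 n (v : 'rV[R]_n) : (sqn v == 0) = (v == 0).
Proof.
apply/eqP/eqP => [v0|->]; last exact: sqn0.
apply/rowP => i; rewrite mxE; apply/eqP; rewrite -sqrf_eq0; apply/eqP.
by apply: (psumr_eq0P _ v0) => // j _; rewrite sqr_ge0.
Qed.

Lemma sqn_gt0 n (v : 'rV[R]_n) : (0 < sqn v) = (v != 0).
Proof. by rewrite lt_neqAle sqn_ge0 andbT eq_sym sqn_eq0. Qed.

Lemma enormZ n (k : R) (v : 'rV[R]_n) : enorm (k *: v) = `|k| * enorm v.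
Proof.
rewrite /enorm -sqrtr_sqr -sqrtrM ?sqr_ge0// mulr_sumr; congr Num.sqrt.
by apply: eq_bigr => i _; rewrite mxE exprMn.
Qed.

Lemma measurable_sqnB n (u : 'rV[R]_n) :
  measurable_fun [set: 'rV[R]_n] (fun v => sqn (v - u)).
Proof.
apply: measurable_sum => i; apply: measurable_funX.
under eq_fun do rewrite !mxE; apply: measurable_funB => //.
exact: measurable_rV_proj.
Qed.

Lemma measurable_enormB n (u : 'rV[R]_n) :
  measurable_fun [set: 'rV[R]_n] (fun v => enorm (v - u)).
Proof.
rewrite (_ : (fun _ => _) = (fun x => x `^ 2^-1) \o (fun v => sqn (v - u))).
  by apply: measurableT_comp => //; exact: measurable_sqnB.
by apply/funext => v /=; rewrite powR12_sqrt// sqn_ge0.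
Qed.

Lemma measurable_enorm n : measurable_fun [set: 'rV[R]_n] (@enorm R n).
Proof.
rewrite (_ : @enorm R n = (fun v => enorm (v - 0))); first exact: measurable_enormB.
by apply/funext => v; rewrite subr0.
Qed.

Lemma measurable_rV_set1 n (u : 'rV[R]_n) : measurable [set u].
Proof.
rewrite (_ : [set u] = (fun v => sqn (v - u)) @^-1` [set 0]).
  by rewrite -[X in measurable X]setTI; exact: measurable_sqnB.
by apply/seteqP; split=> v /=; [move->; rewrite subrr sqn0|
  move/eqP; rewrite sqn_eq0 subr_eq0 => /eqP].
Qed.

(** The indicator of a point is the product of the indicators of its
coordinates. *)
Lemma lebesgue_rV_set1 n (u : 'rV[R]_n.+1) : lebesgue_rV n.+1 [set u] = 0%E.
Proof.
rewrite -[X in lebesgue_rV _ X]setIT -integral_indic//; last exact: measurable_rV_set1.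
have P0 : \prod_(i < n.+1) (fun=> 0 : R) i = 0 by rewrite big_ord_recl mul0r.
rewrite -[RHS]/((0 : R)%:E) -P0.
rewrite -(@integral_rV_prod R n.+1 (fun i => \1_[set u 0 i]) (fun=> 0)).
- apply: eq_integral => v _; congr EFin; rewrite indicE.
  have [/set_mem/= ->|vu] := boolP (v \in [set u]).
    by rewrite big1// => i _; rewrite indicE mem_set.
  have [i /negbTE viu] : exists i, v 0 i != u 0 i.
    apply/existsP; apply: contraNT vu; rewrite negb_exists => /forallP vu.
    by apply/mem_set/rowP => i; apply/eqP; have := vu i; rewrite negbK.
  rewrite (bigD1 i)//= indicE memNset ?mul0r//= => /eqP; by rewrite viu.
- by move=> i; exact: measurable_indic.
- by move=> i x; rewrite indicE.
- move=> i; rewrite integral_indic// setIT; exact: lebesgue_measure_set1.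
Qed.

(** The one-dimensional scaling is used once for each coordinate. *)
Lemma ge0_integral_rV_scale n (k : R) (f : 'rV[R]_n -> \bar R) : 0 < k ->
  measurable_fun setT f -> (forall v, (0 <= f v)%E) ->
  (\int[lebesgue_rV n]_v f v = (k ^+ n)%:E * \int[lebesgue_rV n]_v f (k *: v)%R)%E.
Proof.
move=> k0.
have mscale m : measurable_fun setT (fun v : 'rV[R]_m => k *: v).
  apply: measurable_fun_rVP => i; under eq_fun do rewrite mxE.
  by apply: measurable_funM => //; exact: measurable_rV_proj.
elim: n f => [|n IHn] f mf f0.
  rewrite ge0_integral_rV0// expr0 mul1e ge0_integral_rV0 ?scaler0//.
  exact: (measurableT_comp mf (mscale 0%N)).
have consZ x (w : 'rV[R]_n) : rV_cons (k * x, k *: w) = k *: rV_cons (x, w).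
  by apply/rowP => i; rewrite !mxE/=; case: unlift => [j|]//; rewrite mxE.
have mcons g : measurable_fun setT g ->
    measurable_fun setT (fun p : measurableTypeR R * 'rV[R]_n => g (rV_cons p) : \bar R).
  by move=> mg; apply: measurableT_comp => //; exact: measurable_rV_cons.
have mfx g : measurable_fun setT g -> (forall v, (0 <= g v)%E) ->
   measurable_fun [set: measurableTypeR R] (fun x => \int[lebesgue_rV n]_w (g (rV_cons (x, w))))%E.
  move=> mg g0.
  exact: (@measurable_fun_fubini_tonelli_F _ _ _ _ _ (lebesgue_rV n)
    (fun p => g (rV_cons p)) (mcons g mg) (fun=> g0 _)).
have mfZ : measurable_fun setT (fun v : 'rV_n.+1 => f (k *: v)).
  exact: (measurableT_comp mf (mscale n.+1)).
rewrite ge0_integral_rVS// (@ge0_integral_affine R k 0 k0); last 2 first.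
- exact: mfx.
- by move=> x; apply: integral_ge0.
rewrite ge0_integral_rVS// exprS EFinM -muleA; congr (_ * _)%E.
rewrite -ge0_integralZl//; last 3 first.
- exact: (mfx (fun v => f (k *: v))).
- by move=> x _; exact: integral_ge0.
- by rewrite lee_fin exprn_ge0// ltW.
apply: eq_integral => x _; rewrite addr0 IHn//.
  by congr (_ * _)%E; apply: eq_integral => w _; rewrite consZ.
exact: (@measurable_fun_pair2 _ _ _ _ _ _ (fun p => f (rV_cons p))
  (k * x) (mcons f mf)).
Qed.

End sqn_theory.

(** * Volume of balls and area of the unit sphere *)

Section enorm_triangle.
Context {R : realType} (n : nat).
Implicit Types u v : 'rV[R]_n.

Lemma enorm_eq0 u : (enorm u == 0) = (u == 0).
Proof. by rewrite -sqn_eq0 -sqr_enorm sqrf_eq0. Qed.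

(** Cauchy-Schwarz, from the nonnegativity of the sum of the squares
(u_i / |u| - v_i / |v|)^2. *)
Lemma dot_le_enorm u v : \sum_(i < n) u 0 i * v 0 i <= enorm u * enorm v.
Proof.
have [->|u0] := eqVneq u 0.
  rewrite big1 ?mulr_ge0 ?enorm_ge0// => i _; by rewrite mxE mul0r.
have [->|v0] := eqVneq v 0.
  rewrite big1 ?mulr_ge0 ?enorm_ge0// => i _; by rewrite mxE mulr0.
have U : 0 < enorm u by rewrite lt_neqAle enorm_ge0 andbT eq_sym enorm_eq0.
have V : 0 < enorm v by rewrite lt_neqAle enorm_ge0 andbT eq_sym enorm_eq0.
have : 0 <= \sum_(i < n) (u 0 i / enorm u - v 0 i / enorm v) ^+ 2.
  by apply: sumr_ge0 => i _; exact: sqr_ge0.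
rewrite (eq_bigr (fun i => (u 0 i ^+ 2 / enorm u ^+ 2
    + v 0 i ^+ 2 / enorm v ^+ 2) -
    u 0 i * v 0 i * (2 / (enorm u * enorm v)))); last first.
  by move=> i _; field; rewrite !gt_eqF.
rewrite sumrB big_split/= -!mulr_suml -!/(sqn _) -!sqr_enorm.
rewrite !divff ?sqrf_eq0 ?gt_eqF//.
rewrite subr_ge0 mulrA ler_pdivrMr ?mulr_gt0// => h; lra.
Qed.

Lemma enormD u v : enorm (u + v) <= enorm u + enorm v.
Proof.
rewrite -ler_sqr ?nnegrE ?addr_ge0 ?enorm_ge0// sqr_enorm sqrrD !sqr_enorm.
have -> : sqn (u + v) = sqn u + 2 * (\sum_(i < n) u 0 i * v 0 i) + sqn v.
  rewrite /sqn mulr_sumr -!big_split/=; apply: eq_bigr => i _.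
  by rewrite mxE sqrrD mulr2n; ring.
by rewrite lerD2r lerD2l mulr2n mulr2n mulrDl !mul1r lerD// dot_le_enorm.
Qed.

Lemma enormN u : enorm (- u) = enorm u.
Proof. by rewrite -scaleN1r enormZ normrN1 mul1r. Qed.

Lemma enormBC u v : enorm (u - v) = enorm (v - u).
Proof. by rewrite -enormN opprB. Qed.

End enorm_triangle.

Section balls.
Context {R : realType} (n : nat).

Definition cball (r : R) : set 'rV[R]_n := [set v | enorm v <= r].
Definition oball (r : R) : set 'rV[R]_n := [set v | enorm v < r].

Lemma measurable_cball r : measurable (cball r).
Proof.
rewrite (_ : cball r = @enorm R n @^-1` `]-oo, r]).
  by rewrite -[X in measurable X]setTI; exact: measurable_enorm.
by apply/seteqP; split=> v /=; rewrite in_itv.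
Qed.

Lemma measurable_oball r : measurable (oball r).
Proof.
rewrite (_ : oball r = @enorm R n @^-1` `]-oo, r[).
  by rewrite -[X in measurable X]setTI; exact: measurable_enorm.
by apply/seteqP; split=> v /=; rewrite in_itv.
Qed.

Let vol_scale (A B : set 'rV[R]_n) r : 0 < r -> measurable A -> measurable B ->
  (forall v, A (r *: v) <-> B v) ->
  lebesgue_rV n A = ((r ^+ n)%:E * lebesgue_rV n B)%E.
Proof.
move=> r0 mA mB AB.
rewrite -[A in LHS]setIT -[B in RHS]setIT -!integral_indic//.
rewrite (ge0_integral_rV_scale r0); last 2 first.
- by apply/measurable_EFinP; exact: measurable_indic.
- by move=> v; rewrite lee_fin.
congr (_ * _)%E; apply: eq_integral => v _; congr EFin.
rewrite !indicE; congr (nat_of_bool _)%:R; apply/idP/idP => /set_mem/AB Av; exact/mem_set.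
Qed.

Lemma lebesgue_rV_cball r : 0 < r ->
  lebesgue_rV n (cball r) = ((r ^+ n)%:E * lebesgue_rV n (cball 1))%E.
Proof.
move=> r0; apply: vol_scale => //; [exact: measurable_cball..|].
by move=> v; rewrite /cball/= enormZ gtr0_norm// ger_pMr.
Qed.

Lemma lebesgue_rV_oball_scale r : 0 < r ->
  lebesgue_rV n (oball r) = ((r ^+ n)%:E * lebesgue_rV n (oball 1))%E.
Proof.
move=> r0; apply: vol_scale => //; [exact: measurable_oball..|].
by move=> v; rewrite /oball/= enormZ gtr0_norm// gtr_pMr.
Qed.

Lemma normr_coord_le_enorm (v : 'rV[R]_n) i : `|v 0 i| <= enorm v.
Proof.
rewrite -ler_sqr ?nnegrE ?enorm_ge0// sqr_enorm real_normK ?num_real//.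
by rewrite /sqn (bigD1 i)//= lerDl sumr_ge0// => j _; rewrite sqr_ge0.
Qed.

Lemma lebesgue_rV_cball1_fin : lebesgue_rV n (cball 1) \is a fin_num.
Proof.
rewrite ge0_fin_numE//.
apply: (@le_lt_trans _ _ (\prod_(i < n) (2 : R))%:E); last exact: ltry.
rewrite -(@integral_rV_prod R n (fun i => \1_`[(-1), 1]) (fun=> 2)).
- rewrite -[X in lebesgue_rV n X]setIT -integral_indic//; last exact: measurable_cball.
  apply: ge0_le_integral => //.
  + by apply/measurable_EFinP; apply: measurable_indic; exact: measurable_cball.
  + apply/measurable_EFinP; apply: measurable_prod => i _.
    apply: measurableT_comp; last exact: measurable_rV_proj.
    exact: measurable_indic.
  + move=> v _; rewrite lee_fin [leLHS]indicE.
    have [/set_mem v1|_] := boolP (v \in cball 1).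
      rewrite big1// => i _; rewrite indicE mem_set//= in_itv/= -ler_norml.
      by rewrite (le_trans (normr_coord_le_enorm _ _)).
    by rewrite prodr_ge0// => i _.
- by move=> i; exact: measurable_indic.
- by move=> i x; rewrite indicE.
- move=> i; rewrite integral_indic// setIT.
  have /= -> := lebesgue_measure_itv `[(-1 : R), 1].
  rewrite lte_fin (_ : (-1 < 1 :> R)%R = true); first by rewrite -EFinB opprK.
  by apply/idP; lra.
Qed.

Definition ball_vol : R := fine (lebesgue_rV n (cball 1)).

Lemma lebesgue_rV_cballE r : 0 < r ->
  lebesgue_rV n (cball r) = (r ^+ n * ball_vol)%:E.
Proof.
by move=> r0; rewrite lebesgue_rV_cball// EFinM fineK// lebesgue_rV_cball1_fin.
Qed.

(** Open and closed balls have the same volume: the open unit ball contains the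
closed balls of radius x < 1, of volume x^n times that of the closed unit
ball. *)
Lemma lebesgue_rV_oball r : 0 < r ->
  lebesgue_rV n (oball r) = (r ^+ n * ball_vol)%:E.
Proof.
move=> r0; rewrite lebesgue_rV_oball_scale// EFinM; congr (_ * _)%E.
have ole : (lebesgue_rV n (oball 1) <= ball_vol%:E)%E.
  rewrite -[ball_vol]mul1r -[X in X * _](expr1n _ n) -lebesgue_rV_cballE//.
  apply: le_measure; rewrite ?inE; [exact: measurable_oball|exact: measurable_cball|].
  by move=> v; exact: ltW.
have ofin : lebesgue_rV n (oball 1) \is a fin_num.
  by rewrite ge0_fin_numE// (le_lt_trans ole)// ltry.
apply/eqP; rewrite eq_le ole/= -(fineK ofin) lee_fin.
have cv : (x ^+ n * ball_vol) @[x --> (1 : R)^'-] --> ball_vol.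
  rewrite -[X in _ --> X]mul1r -[X in X * _](expr1n _ n).
  by apply: cvg_at_left_filter; apply: cvgMr_tmp; exact: exprn_continuous.
apply: (cvgr_to_le cv).
near=> x; rewrite -lee_fin fineK// -lebesgue_rV_cballE//.
apply: le_measure; rewrite ?inE; [exact: measurable_cball|exact: measurable_oball|].
by move=> v /= vx; rewrite /oball/= (le_lt_trans vx).
Unshelve. all: by end_near. Qed.

End balls.

Section sphere_area.
Context {R : realType} (n : nat).

(** A point y of the shell is at distance | |y| - 1 | from y / |y|, and by the
triangle inequality no point of the sphere is closer to it. *)
Lemma tube_sphere (e : R) : 0 < e < 1 ->
  tube [set x : 'rV[R]_n | enorm x = 1] e = oball (1 + e) `\` cball (1 - e).
Proof.
move=> /andP[e0 e1]; apply/seteqP; split=> y /=.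
  move=> [x x1 yx]; split.
    by rewrite /oball/= -(subrK x y) (le_lt_trans (enormD _ _))// x1 addrC ltrD2l.
  apply/negP; rewrite /cball/= -ltNge ltrBlDr -x1 -(subrK y x).
  by rewrite (le_lt_trans (enormD _ _))// enormBC addrC ltrD2l.
move=> [y1 /negP]; rewrite /cball/= -ltNge => y2.
have y0 : 0 < enorm y by rewrite (lt_trans _ y2)// subr_gt0.
exists ((enorm y)^-1 *: y) => /=.
  by rewrite enormZ ger0_norm ?invr_ge0 ?enorm_ge0// mulVf// gt_eqF.
rewrite -[X in X - _]scale1r -scalerBl enormZ -[X in _ * X]gtr0_norm// -normrM.
rewrite mulrBl mul1r mulVf ?gt_eqF// ltr_norml; apply/andP; split.
  by rewrite ltrBrDl.
by rewrite ltrBlDl.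
Qed.

(** The shell between the radii 1 - e and 1 + e has volume
((1 + e)^n - (1 - e)^n) times that of the unit ball; dividing by 2e leaves the
sum of the (1 + e)^(n-1-i) (1 - e)^i, which tends to n. *)
Lemma s_dE : @s_d R n = n%:R * ball_vol n.
Proof.
apply/cvg_lim => //.
have ct : continuous (fun e : R => \sum_(i < n) (1 + e) ^+ (n.-1 - i) * (1 - e) ^+ i).
  apply: continuous_big => [p|i _ e]; first by apply: cvgD; [exact: cvg_fst|exact: cvg_snd].
  apply: cvgM.
    apply: (cvg_comp (fun e => 1 + e) (fun x => x ^+ _)); last exact: exprn_continuous.
    by apply: cvgD; [exact: cvg_cst|exact: cvg_id].
  apply: (cvg_comp (fun e => 1 - e) (fun x => x ^+ _)); last exact: exprn_continuous.
  by apply: cvgB; [exact: cvg_cst|exact: cvg_id].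
have cv : (\sum_(i < n) (1 + e) ^+ (n.-1 - i) * (1 - e) ^+ i) * ball_vol n
    @[e --> (0 : R)^'+] --> n%:R * ball_vol n.
  apply: cvg_at_right_filter; apply: cvgMr_tmp.
  rewrite [X in _ --> X](_ : _ = \sum_(i < n)
      ((1 + 0) ^+ (n.-1 - i) * (1 - 0) ^+ i : R)); first exact: ct.
  rewrite addr0 subr0 (eq_bigr (fun=> 1)) ?sumr_const ?card_ord//.
  by move=> i _; rewrite !expr1n mulr1.
apply: cvg_trans cv; apply: near_eq_cvg; near=> e.
have e0 : 0 < e by [].
have e1 : e < 1 by near: e; apply: nbhs_right_lt.
have e1' : 0 < 1 - e by rewrite subr_gt0.
rewrite tube_sphere ?e0// measureD; last 3 first.
- exact: measurable_oball.
- exact: measurable_cball.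
- change (lebesgue_rV n (oball (1 + e)) < +oo)%E.
  rewrite lebesgue_rV_oball ?ltry//; lra.
rewrite setIidr; last by move=> v; rewrite /cball /oball/= => h; lra.
change ((\sum_(i < n) (1 + e) ^+ (n.-1 - i) * (1 - e) ^+ i) * ball_vol n =
  fine (@lebesgue_rV R n (oball (1 + e)) - @lebesgue_rV R n (cball (1 - e))) / (2 * e)).
rewrite lebesgue_rV_oball ?lebesgue_rV_cballE//; last by lra.
rewrite -EFinB/= -mulrBl subrXX (_ : 1 + e - (1 - e) = 2 * e); last by ring.
by set S := \sum_(i < n) _; field; rewrite gt_eqF.
Unshelve. all: by end_near. Qed.

End sphere_area.

(** * The heat kernel *)

(** The heat kernel as a function of the time and of the squared distance q. *)
Definition hk {R : realType} (d : nat) (s q : R) : R :=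
  ((4 * pi * s) `^ (d%:R / 2))^-1 * expR (- (q / (4 * s))).

Section heat.
Context {R : realType}.
Local Notation leb := (@lebesgue_measure R).
Implicit Types (s t q : R) (d : nat).

Lemma heat_kernelE d t (b y : 'rV[R]_d) : heat_kernel t b y = hk d t (sqn (y - b)).
Proof. by rewrite /heat_kernel sqr_enorm. Qed.

Lemma hk_ge0 d s q : 0 <= hk d s q.
Proof. by rewrite mulr_ge0 ?invr_ge0 ?powR_ge0 ?expR_ge0. Qed.

Lemma hk_gt0 d s q : 0 < s -> 0 < hk d s q.
Proof.
move=> s0; rewrite mulr_gt0 ?expR_gt0// invr_gt0 powR_gt0//.
by rewrite !mulr_gt0// pi_gt0.
Qed.

Lemma measurable_inv : measurable_fun [set: R] (@GRing.inv R).
Proof.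
rewrite (_ : GRing.inv = (fun x => x * ((x ^+ 2) `^ (-1)))).
  apply: measurable_funM => //; apply: (measurableT_comp (measurable_powR _)).
  exact: measurable_funX.
apply/funext => x; have [->|x0] := eqVneq x 0; first by rewrite invr0 mul0r.
by rewrite powR_inv1 ?sqr_ge0//; field.
Qed.

Lemma measurable_hk disp (T : measurableType disp) d (f g : T -> R) :
  measurable_fun setT f -> measurable_fun setT g ->
  measurable_fun setT (fun z => hk d (f z) (g z)).
Proof.
move=> mf mg; apply: measurable_funM.
  apply: (measurableT_comp measurable_inv).
  apply: (measurableT_comp (measurable_powR _)).
  exact: measurable_funM.
apply: (measurableT_comp (@measurable_expR R)); apply: measurableT_comp => //.
apply: measurable_funM => //; apply: (measurableT_comp measurable_inv).
exact: measurable_funM.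
Qed.

Lemma hk1E s q : 0 < s ->
  hk 1 s q = (Num.sqrt (4 * pi * s))^-1 * expR (- (q / (4 * s))).
Proof.
move=> s0; by rewrite /hk mul1r powR12_sqrt// ltW// !mulr_gt0// pi_gt0.
Qed.

(** The Gaussian is a product of one-dimensional Gaussians: this reduces its
integrals to dimension one. *)
Lemma hk_prod d s (v : 'rV[R]_d) : 0 < s ->
  hk d s (sqn v) = \prod_(i < d) hk 1 s (v 0 i ^+ 2).
Proof.
move=> s0; rewrite big_split/= prodr_const card_ord -expR_sum sumrN -mulr_suml.
rewrite /hk exprVn -powR_mulrn ?powR_ge0// -powRrM; congr ((_ `^ _)^-1 * _).
by rewrite mul1r mulrC.
Qed.

(** Completing the square: the integrand is the right-hand side times the
density in w of the normal law of mean (t x + s y) / (s + t) and variance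
2 s t / (s + t). *)
Lemma integral_hk1_conv s t x y : 0 < s -> 0 < t ->
  (\int[leb]_w (hk 1 s ((w - x) ^+ 2) * hk 1 t ((w - y) ^+ 2))%:E
   = (hk 1 (s + t) ((x - y) ^+ 2))%:E)%E.
Proof.
move=> s0 t0; have st0 : 0 < s + t by exact: addr_gt0.
have p0 : 0 < pi :> R by exact: pi_gt0.
pose m := (t * x + s * y) / (s + t); pose v := 2 * s * t / (s + t).
have v0 : 0 < v by rewrite divr_gt0// !mulr_gt0.
have sv0 : Num.sqrt v != 0 by rewrite gt_eqF// sqrtr_gt0.
transitivity (\int[leb]_w
   ((hk 1 (s + t) ((x - y) ^+ 2))%:E * (normal_pdf m (Num.sqrt v) w)%:E))%E.
  apply: eq_integral => w _; rewrite -EFinM; congr EFin.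
  rewrite normal_pdfE// /normal_peak /normal_fun sqr_sqrtr ?ltW//.
  rewrite !hk1E// mulrACA [RHS]mulrACA -!expRD -!invfM; congr (_^-1 * expR _).
    rewrite -!sqrtrM; [congr Num.sqrt| |]; try by rewrite ltW// !mulr_gt0.
    by rewrite /v mulr2n; field; rewrite gt_eqF.
  by rewrite /v /m mulr2n; field; rewrite !gt_eqF// addr_gt0// !mulr_gt0//.
rewrite ge0_integralZl//.
- by rewrite integral_normal_pdf mule1.
- by apply/measurable_EFinP; exact: measurable_normal_pdf.
- by move=> w _; rewrite lee_fin normal_pdf_ge0.
- by rewrite lee_fin hk_ge0.
Qed.

(** Semigroup property of the heat kernel. *)
Lemma integral_hk_conv d s t (x y : 'rV[R]_d) : 0 < s -> 0 < t ->
  (\int[lebesgue_rV d]_w (hk d s (sqn (w - x)) * hk d t (sqn (w - y)))%:E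
   = (hk d (s + t) (sqn (x - y)))%:E)%E.
Proof.
move=> s0 t0.
rewrite [in RHS]hk_prod ?addr_gt0//.
under eq_bigr do rewrite !mxE.
rewrite -(@integral_rV_prod R d (fun i w => hk 1 s ((w - x 0 i) ^+ 2)
   * hk 1 t ((w - y 0 i) ^+ 2)) (fun i => hk 1 (s + t) ((x 0 i - y 0 i) ^+ 2))).
- apply: eq_integral => w _; congr EFin; rewrite !hk_prod// -big_split/=.
  by apply: eq_bigr => i _; rewrite !mxE.
- move=> i; apply: measurable_funM; apply: measurable_hk => //;
    by apply: measurable_funX; exact: measurable_funB.
- by move=> i w; rewrite mulr_ge0 ?hk_ge0.
- by move=> i; exact: integral_hk1_conv.
Qed.

Lemma integral_hk d t (y : 'rV[R]_d) : 0 < t ->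
  (\int[lebesgue_rV d]_w (hk d t (sqn (w - y)))%:E = 1)%E.
Proof.
move=> t0.
have sv0 : Num.sqrt (2 * t) != 0 by rewrite gt_eqF// sqrtr_gt0 mulr_gt0.
have p0 : 0 < pi :> R by exact: pi_gt0.
rewrite (_ : 1%E = (\prod_(i < d) (1 : R))%:E); last by rewrite big1.
rewrite -(@integral_rV_prod R d (fun i w => hk 1 t ((w - y 0 i) ^+ 2)) (fun=> 1)).
- apply: eq_integral => w _; congr EFin; rewrite !hk_prod//.
  by apply: eq_bigr => i _; rewrite !mxE.
- move=> i; apply: measurable_hk => //.
  by apply: measurable_funX; exact: measurable_funB.
- by move=> i w; rewrite hk_ge0.
- move=> i; rewrite -(integral_normal_pdf (y 0 i) (Num.sqrt (2 * t))).
  apply: eq_integral => w _; congr EFin.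
  rewrite normal_pdfE// /normal_peak /normal_fun sqr_sqrtr ?ltW// ?mulr_gt0//.
  rewrite hk1E// mulr2n; congr ((Num.sqrt _)^-1 * expR _); first by ring.
  by field; rewrite gt_eqF.
Qed.

Lemma measurable_hk_sqn d t (y : 'rV[R]_d) :
  measurable_fun setT (fun w : 'rV[R]_d => hk d t (sqn (w - y))).
Proof. by apply: measurable_hk => //; exact: measurable_sqnB. Qed.

End heat.

(** * The fundamental theorem of calculus for derivatives given pointwise *)

Section ftc.
Context {R : realType}.
Local Notation leb := (@lebesgue_measure R).
Implicit Types (f F : R -> R) (a b x l : R).

Lemma is_derive_continuous F (x l : R) : is_derive x 1 F l -> {for x, continuous F}.
Proof. by move=> h; apply/differentiable_continuous/derivable1_diffP; exact: ex_derive. Qed.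

Lemma integral_itvcc_derive f F a b : a <= b ->
  (forall x, a <= x <= b -> is_derive x 1 F (f x)) ->
  (forall x, a <= x <= b -> {for x, continuous f}) ->
  (\int[leb]_(x in `[a, b]) (f x)%:E = (F b - F a)%:E)%E.
Proof.
rewrite le_eqVlt => /predU1P[<- _ _|ab dF cf].
  by rewrite set_itv1 integral_set1 subrr.
have in_cc x : x \in `]a, b[ -> a <= x <= b.
  by rewrite in_itv/= => /andP[/ltW -> /ltW ->].
have aab : a <= a <= b by rewrite lexx ltW.
have bab : a <= b <= b by rewrite lexx ltW.
rewrite EFinB; apply: continuous_FTC2 => //.
- apply/continuous_within_itvP => //; split.
  + by move=> x /in_cc; exact: cf.
  + by apply: cvg_at_right_filter; exact: cf.
  + by apply: cvg_at_left_filter; exact: cf.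
- split.
  + by move=> x /in_cc xab; apply: ex_derive; exact: dF.
  + by apply: cvg_at_right_filter; exact: (is_derive_continuous (dF _ aab)).
  + by apply: cvg_at_left_filter; exact: (is_derive_continuous (dF _ bab)).
- by move=> x /in_cc xab; rewrite derive1E; have [_ ->] := dF _ xab.
Qed.

Lemma ge0_integral_itvcy_derive f F a l :
  (forall x, a <= x -> 0 <= f x) ->
  (forall x, a <= x -> is_derive x 1 F (f x)) ->
  (forall x, a <= x -> {for x, continuous f}) ->
  F x @[x --> +oo] --> l ->
  (\int[leb]_(x in `[a, +oo[) (f x)%:E = (l - F a)%:E)%E.
Proof.
move=> f0 dF cf Fl; rewrite EFinB; apply: ge0_continuous_FTC2y => //.
- apply/continuous_within_itvcyP; split.
    by move=> x; rewrite in_itv/= andbT => /ltW; exact: cf.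
  by apply: cvg_at_right_filter; exact: cf.
- by move=> x /ltW ax; apply: ex_derive; exact: dF.
- by apply: cvg_at_right_filter; exact: (is_derive_continuous (dF _ (lexx a))).
- by move=> x; rewrite in_itv/= andbT => /ltW ax; rewrite derive1E; have [_ ->] := dF _ ax.
Qed.

(** Exhaustion of the half-open interval by the intervals starting at b / (n + 1):
only the limit of the primitive at 0 is required, as the integrand and the
primitive may have meaningless values there. *)
Lemma ge0_integral_itv0c_derive f F b l : 0 < b ->
  (forall x, 0 < x -> 0 <= f x) ->
  (forall x, 0 < x -> is_derive x 1 F (f x)) ->
  (forall x, 0 < x -> {for x, continuous f}) ->
  F x @[x --> 0^'+] --> l ->
  (\int[leb]_(x in `]0%R, b]) (f x)%:E = (F b - l)%:E)%E.
Proof.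
move=> b0 f0 dF cf Fl.
pose a n : R := b / n.+1%:R.
have a0 n : 0 < a n by rewrite divr_gt0.
have ab n : a n <= b by rewrite ler_pdivrMr// ler_peMr ?ler1n// ltW.
have acv : a n @[n --> \oo] --> (0 : R).
  rewrite -(mulr0 b); apply: cvgM; first exact: cvg_cst.
  exact: cvg_harmonic.
have cupE : `]0, b]%classic = \bigcup_n `[a n, b]%classic.
  apply/seteqP; split=> x /=; rewrite in_itv/=.
    move=> /andP[x0 xb].
    have [n _ /(_ _ (leqnn n)) an] : \forall n \near \oo, a n <= x.
      by apply: (cvgr_le _ acv).
    by exists n => //=; rewrite in_itv/= an.
  by move=> [n _ /=]; rewrite in_itv/= => /andP[anx ->]; rewrite (lt_le_trans (a0 n)).
have mf : measurable_fun (`]0, +oo[%classic : set (measurableTypeR R)) f.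
  apply: open_continuous_measurable_fun => // x; rewrite inE/= in_itv/= andbT.
  exact: cf.
pose I i := `[a i, b]%classic.
have h : (\int[leb]_(x in I i) (f x)%:E)%E @[i --> \oo] -->
    (\int[leb]_(x in \bigcup_i I i) (f x)%:E)%E.
  apply: ge0_nondecreasing_set_cvg_integral => //.
  - move=> m n mn; apply/subsetPset => x; rewrite /I/= !in_itv/= => /andP[amx ->].
    rewrite andbT (le_trans _ amx)// /a ler_pM2l// lef_pV2 ?posrE// ler_nat.
    by rewrite ltnS.
  - by move=> n; exact: measurable_itv.
  - move=> n; apply/measurable_EFinP; apply: measurable_funS mf => //.
    move=> x; rewrite /I/= !in_itv/= andbT => /andP[anx _].
    by rewrite (lt_le_trans (a0 n)).
  - move=> n x; rewrite /I/= in_itv/= => /andP[anx _].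
    by rewrite lee_fin f0// (lt_le_trans (a0 n)).
rewrite cupE; apply: (cvg_unique (@ereal_hausdorff R) h).
rewrite (_ : (fun n => _) = (fun n => (F b - F (a n))%:E)); last first.
  apply/funext => n; apply: integral_itvcc_derive => // x /andP[anx _].
    by apply: dF; rewrite (lt_le_trans (a0 n)).
  by apply: cf; rewrite (lt_le_trans (a0 n)).
apply: cvg_EFin; first exact: nearW.
apply: cvgB; first exact: cvg_cst.
by move/cvg_at_rightP: Fl; apply.
Qed.

End ftc.

(** * The Gaussian as a mixture of balls *)

Section mixture.
Context {R : realType}.
Local Notation leb := (@lebesgue_measure R).
Implicit Types (s u r q : R).

Lemma integral_if (P : R -> bool) (f : R -> R) :
  (\int[leb]_x (if P x then f x else 0)%:E = \int[leb]_(x in [set x | P x]) (f x)%:E)%E.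
Proof.
rewrite [RHS]integral_mkcond; apply: eq_integral => x _; rewrite patchE.
case: ifPn => Px; first by rewrite mem_set.
by rewrite memNset//=; apply/negP.
Qed.

(** For s > 0, exp (- 1 / (4 s)) increases from 0 to 1; its derivative
[phi] is the density of the mixture below. *)
Definition expV s : R := expR (- (1 / (4 * s))).
Definition phi s : R := expV s / (4 * s ^+ 2).

Lemma is_derive_expV s : 0 < s -> is_derive s 1 expV (phi s).
Proof.
move=> s0; have s0' : 4 * s != 0 by rewrite mulf_neq0 ?gt_eqF.
have h : is_derive s 1 (fun s => - (1 / (4 * s))) ((4 * s ^+ 2)^-1).
  rewrite (_ : (fun s => _) = (fun s => - ((fun s => 4 * s) s)^-1)); last first.
    by apply/funext => x; rewrite div1r.
  have h4 : is_derive s 1 (fun s : R => 4 * s) 4.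
    by apply: is_derive_eq; rewrite /GRing.scale/=; ring.
  have := is_deriveN (is_deriveV s0' h4).
  move=> h; apply: (is_derive_eq h).
  by rewrite /GRing.scale/=; field; rewrite gt_eqF.
have := @is_derive1_comp R expR (fun s => - (1 / (4 * s))) s _ _ (is_derive_expR _) h.
by move=> h'; apply: (is_derive_eq h').
Qed.

Lemma continuous_expV s : 0 < s -> {for s, continuous expV}.
Proof. by move=> s0; exact: (is_derive_continuous (is_derive_expV s0)). Qed.

Lemma continuous_phi s : 0 < s -> {for s, continuous phi}.
Proof.
move=> s0; apply: cvgM; first exact: continuous_expV.
apply: cvgV; first by rewrite mulf_neq0 ?sqrf_eq0 ?gt_eqF.
by apply: cvgM; [exact: cvg_cst|exact: exprn_continuous].
Qed.

Lemma phi_ge0 s : 0 <= phi s.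
Proof. by rewrite divr_ge0 ?expR_ge0// mulr_ge0 ?sqr_ge0. Qed.

Lemma expV_cvg0 : expV s @[s --> 0^'+] --> 0.
Proof.
apply: (@squeeze_cvgr _ _ _ _ (fun=> 0) (fun s => 4 * s)).
- near=> s; rewrite expR_ge0/= /expV expRN.
  have s0 : 0 < s by [].
  rewrite invf_ple ?posrE ?expR_gt0 ?mulr_gt0// div1r.
  by apply: le_trans (expR_ge1Dx _); rewrite lerDr.
- exact: cvg_cst.
- apply: cvg_at_right_filter; rewrite -[X in _ --> X](mulr0 4).
  by apply: cvgM; [exact: cvg_cst|exact: cvg_id].
Unshelve. all: by end_near. Qed.

Lemma expV_cvgy : expV s @[s --> +oo%R] --> (1 : R).
Proof.
rewrite -[X in _ --> X](@expR0 R).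
apply: (cvg_comp (fun s => - (1 / (4 * s))) expR); last exact: continuous_expR.
rewrite -oppr0; apply: cvgN.
rewrite (_ : (fun s => _) = (fun s => 4^-1 * s^-1)); last first.
  by apply/funext => s; rewrite div1r invfM.
rewrite -[X in _ --> X](mulr0 4^-1); apply: cvgM; first exact: cvg_cst.
by apply/gtr0_cvgV0; [near=> x|exact: cvg_id].
Unshelve. all: by end_near. Qed.

Lemma integral_phi0c u : 0 < u ->
  (\int[leb]_(s in `]0%R, u]) (phi s)%:E = (expV u)%:E)%E.
Proof.
move=> u0; rewrite -[expV u]subr0; apply: ge0_integral_itv0c_derive => //.
- by move=> x _; exact: phi_ge0.
- exact: is_derive_expV.
- exact: continuous_phi.
- exact: expV_cvg0.
Qed.

Lemma measurable_expV : measurable_fun setT expV.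
Proof.
apply: (measurableT_comp (@measurable_expR R)).
apply: measurable_funN; apply: measurable_funM => //.
by apply: (measurableT_comp measurable_inv); exact: measurable_funM.
Qed.

Lemma measurable_phi : measurable_fun setT phi.
Proof.
apply: measurable_funM; first exact: measurable_expV.
by apply: (measurableT_comp measurable_inv); apply: measurable_funM => //; exact: measurable_funX.
Qed.

Lemma integral_phi : (\int[leb]_(s in `]0%R, +oo[) (phi s)%:E = 1)%E.
Proof.
have m_phi D : measurable_fun D (EFin \o phi).
  by apply/measurable_EFinP; exact: measurable_funTS measurable_phi.
transitivity (\int[leb]_(x in `]0%R, 1%R]) (phi x)%:E
    + \int[leb]_(x in `]1%R, +oo[) (phi x)%:E)%E.
  rewrite -ge0_integral_setU//=.
  - by congr (integral _ _ _); rewrite -itv_bndbnd_setU// bnd_simp.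
  - exact: m_phi.
  - by move=> x _; rewrite lee_fin phi_ge0.
  - rewrite disj_set2E; apply/eqP; rewrite -subset0 => x []/=.
    by rewrite !in_itv/= => /andP[_ x1] /andP[]; rewrite ltNge x1.
rewrite integral_phi0c// integral_itv_obnd_cbnd//.
have -> : (\int[leb]_(x in `[1%R, +oo[) (phi x)%:E = (1 - expV 1)%:E)%E; last first.
  by rewrite -EFinD addrC subrK.
apply: ge0_integral_itvcy_derive.
- by move=> x _; exact: phi_ge0.
- by move=> x x1; apply: is_derive_expV; rewrite (lt_le_trans _ x1).
- by move=> x x1; apply: continuous_phi; rewrite (lt_le_trans _ x1).
- exact: expV_cvgy.
Qed.

(** The indicator is that of 0 < s <= 1 / q.  Read as a function of a point at
squared distance q from the origin, this writes the Gaussian as the mixture,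
with density phi, of the indicators of the balls of squared radius 1 / s. *)
Lemma expV_layer q : 0 <= q ->
  (\int[leb]_s (if (0 < s) && (s * q <= 1) then phi s else 0)%:E
   = (expR (- (q / 4)))%:E)%E.
Proof.
move=> q0; rewrite integral_if; have [->|qn0] := eqVneq q 0.
  rewrite mul0r oppr0 expR0 -integral_phi.
  congr (integral _ _ _); apply/seteqP; split=> s /=; rewrite in_itv/= mulr0 ler01 !andbT//.
have {qn0} q0 : 0 < q by rewrite lt_neqAle eq_sym qn0.
have -> : q / 4 = 1 / (4 * q^-1) by field; rewrite gt_eqF.
rewrite -integral_phi0c ?invr_gt0//.
congr (integral _ _ _); apply/seteqP; split=> s /=; rewrite in_itv/=;
  by rewrite -div1r ler_pdivlMr.
Qed.

End mixture.

(** * The flux constant *)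

Section flux.
Context {R : realType}.
Local Notation leb := (@lebesgue_measure R).
Variable d : nat.
Implicit Types (s u r q : R).

Lemma integral_ifZ (P : R -> bool) (f : R -> R) k : 0 <= k ->
  measurable_fun setT P -> measurable_fun setT f -> (forall x, P x -> 0 <= f x) ->
  (\int[leb]_x (if P x then k * f x else 0)%:E =
   k%:E * \int[leb]_x (if P x then f x else 0)%:E)%E.
Proof.
move=> k0 mP mf f0; rewrite -ge0_integralZl//.
- by apply: eq_integral => x _; rewrite -EFinM; case: ifP; rewrite ?mulr0.
- by apply/measurable_EFinP; exact: measurable_fun_ifT.
- by move=> x _; rewrite lee_fin; case: ifPn => // /f0.
Qed.

Lemma measurable_sqn : measurable_fun setT (@sqn R d).
Proof.
have := @measurable_sqnB R d 0.
by rewrite (_ : (fun _ => _) = @sqn R d)//; apply/funext => v; rewrite subr0.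
Qed.

(** The mass of the Gaussian, computed by integrating its mixture of balls: the
ball of squared radius 1 / s has volume s^(-d/2) times that of the unit ball. *)
Lemma integral_phi_powR :
  (((4 * pi : R) `^ (d%:R / 2))%:E =
   (ball_vol d)%:E *
   \int[leb]_s (if 0 < s then phi s * s `^ (- (d%:R / 2)) else 0)%:E)%E.
Proof.
have C0 : 0 < (4 * pi : R) `^ (d%:R / 2) by rewrite powR_gt0 ?mulr_gt0 ?pi_gt0.
have vol0 : 0 <= ball_vol d :> R by rewrite fine_ge0.
pose f (z : 'rV[R]_d * measurableTypeR R) : \bar R :=
  (if (0 < z.2) && (z.2 * sqn z.1 <= 1) then phi z.2 else 0)%:E.
have mf : measurable_fun setT f.
  apply/measurable_EFinP; apply: measurable_fun_ifT => //; last first.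
    exact: (measurableT_comp (@measurable_phi R) measurable_snd).
  apply: measurable_and; [apply: measurable_fun_ltr|apply: measurable_fun_ler] => //.
  by apply: measurable_funM => //; exact: (measurableT_comp (@measurable_sqn)).
have f0 z : (0 <= f z)%E by rewrite lee_fin; case: ifP => // _; exact: phi_ge0.
transitivity (\int[lebesgue_rV d]_w \int[leb]_s f (w, s))%E.
  under eq_integral => w _ do rewrite /f/= expV_layer ?sqn_ge0//.
  have h := @integral_hk R d 1 0 ltr01.
  rewrite -[LHS]mule1 -h -ge0_integralZl//.
  - apply: eq_integral => w _; rewrite -EFinM /hk !mulr1 mulrA divff ?gt_eqF// mul1r.
    by rewrite subr0.
  - by apply/measurable_EFinP; exact: measurable_hk_sqn.
  - by move=> w _; rewrite lee_fin hk_ge0.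
  - by rewrite lee_fin ltW.
rewrite fubini_tonelli// -ge0_integralZl//; last 2 first.
- apply/measurable_EFinP; apply: measurable_fun_ifT => //.
    exact: measurable_fun_ltr.
  by apply: measurable_funM; [exact: measurable_phi|exact: measurable_powR].
- by move=> s _; rewrite lee_fin; case: ifP => // _; rewrite mulr_ge0 ?phi_ge0 ?powR_ge0.
apply: eq_integral => s _; rewrite -EFinM /f/=; case: ifPn => s0; last first.
  by rewrite mulr0 integral0.
have sr0 : 0 < s `^ (- 2^-1) by exact: powR_gt0.
transitivity (\int[lebesgue_rV d]_w ((phi s)%:E * (\1_(cball (s `^ (- 2^-1))) w)%:E))%E.
  apply: eq_integral => w _; rewrite -EFinM indicE.
  have -> : (w \in cball (s `^ (- 2^-1))) = (s * sqn w <= 1).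
    have -> : (w \in cball (s `^ (- 2^-1))) = (enorm w <= s `^ (- 2^-1)).
      by apply/idP/idP => [/set_mem|h] //; exact/mem_set.
    rewrite -ler_sqr ?nnegrE ?enorm_ge0 ?powR_ge0// sqr_enorm.
    have -> : (s `^ (- 2^-1)) ^+ 2 = s^-1.
      by rewrite -powR_mulrn ?powR_ge0// -powRrM mulNr mulVf// powR_inv1// ltW.
    by rewrite -[s^-1]div1r ler_pdivlMr// mulrC.
  by case: (_ <= 1) => /=; rewrite ?mulr1 ?mulr0.
rewrite ge0_integralZl//; last 2 first.
- by apply/measurable_EFinP; apply: measurable_indic; exact: measurable_cball.
- by rewrite lee_fin phi_ge0.
rewrite integral_indic ?setIT//; last exact: measurable_cball.
change ((phi s)%:E * @lebesgue_rV R d (cball (s `^ (- 2^-1))) =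
  (ball_vol d * (phi s * s `^ (- (d%:R / 2))))%:E)%E.
rewrite lebesgue_rV_cballE// -EFinM; congr EFin.
rewrite -powR_mulrn ?powR_ge0// -powRrM (_ : - 2^-1 * d%:R = - (d%:R / 2)); last first.
  by rewrite mulNr mulrC.
by ring.
Qed.

(** The integral over all times of the outward heat flux -dp_s/dr at distance 1
from the source, which is p_s(1) / (2s). *)
Definition flux : \bar R :=
  (\int[leb]_s (if 0 < s then (2 * s)^-1 * hk d s 1 else 0)%:E)%E.

Hypothesis d0 : (0 < d)%N.

Let r0 : 0 < d%:R / 2 :> R.
Proof. by rewrite divr_gt0// ltr0n. Qed.

Lemma is_derive_powRN s : 0 < s ->
  is_derive s 1 (fun x : R => - x `^ (- (d%:R / 2))) (d%:R / 2 * s `^ (- (d%:R / 2) - 1)).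
Proof.
move=> s0; have := is_deriveN (is_derive1_powR (- (d%:R / 2)) s0).
by move=> h; apply: (is_derive_eq h); rewrite mulNr opprK.
Qed.

Lemma powRN_cvg0 : (- x `^ (- (d%:R / 2)) : R) @[x --> +oo%R] --> (0 : R).
Proof.
rewrite -oppr0; apply: cvgN; under eq_fun do rewrite powRN.
apply/gtr0_cvgV0; first by near=> x; rewrite powR_gt0.
apply/cvgryPge => A; near=> x.
have M0 : 0 < Num.max A 1 by rewrite lt_max ltr01 orbT.
apply: (@le_trans _ _ (Num.max A 1)); first by rewrite le_max lexx.
(* x is beyond max(A, 1)^(2/d), hence its power d/2 is beyond A *)
have MK : (Num.max A 1 `^ (d%:R / 2)^-1) `^ (d%:R / 2) = Num.max A 1.
  by rewrite -powRrM mulVf ?powRr1 ?(ltW M0)// gt_eqF.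
rewrite -[leLHS]MK; apply: (ge0_ler_powR (ltW r0)); rewrite ?nnegrE ?powR_ge0//.
Unshelve. all: by end_near. Qed.

Lemma integral_powR_tail s : 0 < s ->
  (\int[leb]_(u in `[s, +oo[) (d%:R / 2 * u `^ (- (d%:R / 2) - 1))%:E =
   (s `^ (- (d%:R / 2)))%:E)%E.
Proof.
move=> s0; rewrite -[s `^ _]opprK -[X in X%:E]add0r.
have gt0s x : s <= x -> 0 < x by exact: lt_le_trans.
apply: (@ge0_integral_itvcy_derive _ _ (fun x => - x `^ (- (d%:R / 2)))).
- by move=> x _; rewrite mulr_ge0 ?powR_ge0// ltW.
- by move=> x /gt0s; exact: is_derive_powRN.
- move=> x /gt0s x0; apply: cvgM; first exact: cvg_cst.
  exact: (is_derive_continuous (is_derive1_powR _ x0)).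
- exact: powRN_cvg0.
Qed.

(** An integration by parts, done with Tonelli: in [integral_phi_powR], s^(-d/2) is
the integral over u >= s of (d/2) u^(-d/2-1), and integrating phi first, over
0 < s <= u, turns the right-hand side into a multiple of [flux].  In terms of
heat, all of the mass placed at the origin eventually crosses the unit
sphere. *)
Lemma ball_vol_flux : ((ball_vol d)%:E * (d%:R%:E * flux) = 1)%E.
Proof.
have C0 : 0 < (4 * pi : R) `^ (d%:R / 2) by rewrite powR_gt0 ?mulr_gt0 ?pi_gt0.
pose f (z : measurableTypeR R * measurableTypeR R) : \bar R :=
  (if (0 < z.1) && (z.1 <= z.2) then
     phi z.1 * (d%:R / 2 * z.2 `^ (- (d%:R / 2) - 1)) else 0)%:E.
have mf : measurable_fun setT f.
  apply/measurable_EFinP; apply: measurable_fun_ifT => //.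
    by apply: measurable_and; [apply: measurable_fun_ltr|apply: measurable_fun_ler] => //.
  apply: measurable_funM.
    exact: (measurableT_comp (@measurable_phi R) measurable_fst).
  apply: measurable_funM => //.
  exact: (measurableT_comp (@measurable_powR R _) measurable_snd).
have f0 z : (0 <= f z)%E.
  rewrite lee_fin; case: ifP => // _; apply: mulr_ge0; first exact: phi_ge0.
  by rewrite mulr_ge0 ?powR_ge0// ltW.
have key : (\int[leb]_s (if 0 < s then phi s * s `^ (- (d%:R / 2)) else 0)%:E =
    (d%:R * (4 * pi) `^ (d%:R / 2))%:E * flux)%E.
  transitivity (\int[leb]_s \int[leb]_u f (s, u))%E.
    apply: eq_integral => s _; rewrite /f/=; case: ifPn => s0/=; last by rewrite integral0.
    rewrite (@integral_ifZ (fun u => s <= u) (fun u => d%:R / 2 * u `^ (- (d%:R / 2) - 1))).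
    - rewrite integral_if EFinM -integral_powR_tail//; congr (_ * integral _ _ _)%E.
      by apply/seteqP; split=> u /=; rewrite in_itv/= andbT.
    - exact: phi_ge0.
    - exact: measurable_fun_ler.
    - by apply: measurable_funM => //; exact: measurable_powR.
    - by move=> u _; rewrite mulr_ge0 ?powR_ge0.
  rewrite (fubini_tonelli f)// /flux -ge0_integralZl//; last first.
  - by rewrite lee_fin mulr_ge0// ltW.
  - move=> s _; rewrite lee_fin; case: ifP => // s0.
    by rewrite mulr_ge0 ?hk_ge0// invr_ge0 mulr_ge0// ltW.
  - apply/measurable_EFinP; apply: measurable_fun_ifT => //.
      exact: measurable_fun_ltr.
    apply: measurable_funM; last exact: measurable_hk.
    by apply: (measurableT_comp (@measurable_inv R)); exact: measurable_funM.
  apply: eq_integral => u _; rewrite -EFinM /f/=.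
  case: ifPn => u0; last first.
    rewrite mulr0; under eq_integral => s _.
      rewrite (_ : (0 < s) && (s <= u) = false); last first.
        by apply/negP => /andP[s0 su]; move/negP: u0; apply; exact: lt_le_trans su.
      over.
    by rewrite integral0.
  under eq_integral do rewrite mulrC.
  rewrite (@integral_ifZ (fun s => (0 < s) && (s <= u)) phi).
  - rewrite integral_if (_ : [set s | _] = `]0%R, u]%classic); last first.
      by apply/seteqP; split=> s /=; rewrite in_itv/=.
    rewrite integral_phi0c// -EFinM; congr EFin; rewrite /hk -/(expV u).
    have p0 : 0 < pi :> R by exact: pi_gt0.
    rewrite (@powRM _ (4 * pi) u) ?ltW ?mulr_gt0// powRD; last by apply/implyP => _; rewrite gt_eqF.
    rewrite powRN powR_inv1 ?ltW//.
    by field; rewrite !(gt_eqF C0) !gt_eqF// powR_gt0.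
  - by rewrite mulr_ge0 ?powR_ge0.
  - by apply: measurable_and; [apply: measurable_fun_ltr|apply: measurable_fun_ler].
  - exact: measurable_phi.
  - by move=> s _; exact: phi_ge0.
have := integral_phi_powR; rewrite key => h.
have {}h : (((4 * pi) `^ (d%:R / 2))%:E =
    ((4 * pi) `^ (d%:R / 2))%:E * ((ball_vol d)%:E * (d%:R%:E * flux)))%E.
  by rewrite [LHS]h [(d%:R * _)%R]mulrC EFinM muleA !muleA [(_ * (ball_vol d)%:E)%E]muleC.
case: ((ball_vol d)%:E * (d%:R%:E * flux))%E h => [x| |].
- move=> [] /eqP; rewrite -subr_eq0 -[X in X - _]mulr1 -mulrBr mulf_eq0.
  by rewrite gt_eqF//= subr_eq0 => /eqP <-.
- by rewrite mulry gtr0_sg// mul1e.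
- by rewrite mulrNy gtr0_sg// mul1e.
Qed.
End flux.

(** * The radial fundamental solution *)

Section radial_potential.
Context {R : realType}.
Local Notation leb := (@lebesgue_measure R).
Variable d : nat.
Hypothesis d2 : (2 <= d)%N.
Implicit Types (s u r q rho : R).

Let d0 : (0 < d)%N. Proof. exact: leq_trans d2. Qed.

Lemma s_d_flux : s_d d * fine (flux d) = 1 :> R.
Proof.
have := @ball_vol_flux R d d0; rewrite s_dE.
have fl0 : (0 <= @flux R d)%E.
  apply: integral_ge0 => s _; rewrite lee_fin; case: ifP => // s0.
  by rewrite mulr_ge0 ?hk_ge0// invr_ge0 mulr_ge0// ltW.
have dv : (0 : R) < d%:R by rewrite ltr0n.
have vol0 : 0 <= ball_vol d :> R by rewrite fine_ge0.
case: (flux d) fl0 => [c| |] //= _.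
  by rewrite -!EFinM => -[h]; rewrite -[RHS]h; ring.
rewrite gt0_muley ?lte_fin//; move: vol0; rewrite le_eqVlt => /predU1P[<-|v0].
  by rewrite mul0e => -[] /esym/eqP; rewrite oner_eq0.
by rewrite gt0_muley.
Qed.

Lemma flux_gt0 : 0 < fine (flux d) :> R.
Proof.
have := s_d_flux; rewrite s_dE => h.
have fl0 : 0 <= fine (flux d) :> R.
  rewrite fine_ge0//; apply: integral_ge0 => s _; rewrite lee_fin; case: ifP => // s0.
  by rewrite mulr_ge0 ?hk_ge0// invr_ge0 mulr_ge0// ltW.
rewrite lt_neqAle fl0 andbT; apply/eqP => f0; move: h; rewrite -f0 mulr0.
by move/eqP; rewrite eq_sym oner_eq0.
Qed.

Lemma flux_fin : flux d = (fine (flux d) : R)%:E.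
Proof.
have := flux_gt0; case: (flux d) => [c| |]//=; by rewrite ltxx.
Qed.

Lemma s_dV : (s_d d)^-1 = fine (flux d) :> R.
Proof.
have h := s_d_flux; have sd0 : s_d d != 0 :> R.
  by apply/eqP => sd0; move: h; rewrite sd0 mul0r => /eqP; rewrite eq_sym oner_eq0.
by apply: (mulfI sd0); rewrite mulfV// h.
Qed.

(** In the plane the integrand is a multiple of phi, whose integral is 1. *)
Lemma flux2 : @flux R 2 = ((2 * pi)^-1)%:E.
Proof.
have p0 : 0 < pi :> R by exact: pi_gt0.
rewrite /flux.
transitivity (\int[leb]_s (if 0 < s then (2 * pi)^-1 * phi s else 0)%:E)%E.
  apply: eq_integral => s _; congr EFin; case: ifP => // s0.
  rewrite /hk divff// powRr1; last by rewrite ltW// !mulr_gt0.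
  rewrite /phi /expV; move: (pi : R) p0 => P p0; by field; rewrite !gt_eqF.
rewrite (@integral_ifZ _ (fun s => 0 < s) phi).
- rewrite integral_if -[RHS]mule1 -integral_phi; congr (_ * integral _ _ _)%E.
  by apply/seteqP; split=> s /=; rewrite in_itv/= andbT.
- by rewrite invr_ge0 mulr_ge0// ltW.
- exact: measurable_fun_ltr.
- exact: measurable_phi.
- by move=> s _; exact: phi_ge0.
Qed.

Lemma hk_scale s rho q : 0 < rho -> 0 < s ->
  hk d (rho ^+ 2 * s) (rho ^+ 2 * q) = (rho ^+ d)^-1 * hk d s q.
Proof.
move=> r0 s0; have p0 : 0 < pi :> R by exact: pi_gt0.
have rr0 : 0 < rho ^+ 2 by rewrite exprn_gt0.
rewrite /hk (_ : 4 * pi * (rho ^+ 2 * s) = rho ^+ 2 * (4 * pi * s)); last by ring.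
rewrite powRM ?ltW ?mulr_gt0// invfM -[LHS]mulrA; congr (_^-1 * (_ * expR _)).
  rewrite -[rho ^+ 2]powR_mulrn ?ltW// -powRrM mulrCA divff// mulr1.
  by rewrite powR_mulrn// ltW.
by field; rewrite !gt_eqF.
Qed.

(** The heat flux at distance rho is obtained from the one at distance 1 by the
substitution of rho^2 s for s. *)
Lemma flux_scale rho : 0 < rho ->
  (\int[leb]_s (if 0 < s then rho / (2 * s) * hk d s (rho ^+ 2) else 0)%:E =
   (fine (flux d) * (rho / rho ^+ d))%:E)%E.
Proof.
move=> r0; have rr0 : 0 < rho ^+ 2 by rewrite exprn_gt0.
have mhk q : measurable_fun setT (fun s => (2 * s)^-1 * hk d s q).
  apply: measurable_funM; last exact: measurable_hk.
  by apply: (measurableT_comp (@measurable_inv R)); exact: measurable_funM.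
rewrite (@ge0_integral_affine R _ 0 rr0); last 2 first.
- apply/measurable_EFinP; apply: measurable_fun_ifT => //.
    exact: measurable_fun_ltr.
  under eq_fun do rewrite -mulrA; exact: measurable_funM.
- move=> s; rewrite lee_fin; case: ifP => // s0.
  by rewrite mulr_ge0 ?hk_ge0// divr_ge0 ?mulr_ge0// ltW.
rewrite [in RHS]mulrC [in RHS]EFinM -flux_fin.
transitivity ((rho ^+ 2)%:E * \int[leb]_s
   (if 0 < s then (rho / rho ^+ d / rho ^+ 2) * ((2 * s)^-1 * hk d s 1) else 0)%:E)%E.
  congr (_ * _)%E; apply: eq_integral => s _; rewrite addr0 pmulr_rgt0//.
  congr EFin; case: ifP => // s0.
  have -> : hk d (rho ^+ 2 * s) (rho ^+ 2) = (rho ^+ d)^-1 * hk d s 1.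
    by rewrite -hk_scale// mulr1.
  by field; rewrite !gt_eqF// exprn_gt0.
rewrite (@integral_ifZ _ (fun s => 0 < s)); last 4 first.
- by rewrite !divr_ge0 ?exprn_ge0// ltW.
- exact: measurable_fun_ltr.
- exact: mhk.
- by move=> s s0; rewrite mulr_ge0 ?hk_ge0// invr_ge0 mulr_ge0// ltW.
rewrite muleA -EFinM; congr (_%:E * _)%E.
by field; rewrite !gt_eqF// exprn_gt0.
Qed.

Lemma is_derive_hk_rho s rho : 0 < s ->
  is_derive rho 1 (fun r => - hk d s (r ^+ 2)) (rho / (2 * s) * hk d s (rho ^+ 2)).
Proof.
move=> s0.
have h : is_derive rho 1 (fun r => - (r ^+ 2 / (4 * s))) (- (rho / (2 * s))).
  by apply: is_derive_eq; rewrite /GRing.scale/=; field; rewrite gt_eqF.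
have h2 := @is_derive1_comp R expR (fun r => - (r ^+ 2 / (4 * s))) rho _ _
  (is_derive_expR _) h.
have := is_deriveN (is_deriveZ ((4 * pi * s) `^ (d%:R / 2))^-1 h2).
move=> h3; apply: (is_derive_eq h3).
by rewrite /hk /GRing.scale/=; ring.
Qed.

Lemma continuous_hk_flux s rho : 0 < s ->
  {for rho, continuous (fun r => r / (2 * s) * hk d s (r ^+ 2))}.
Proof.
move=> s0; apply: cvgM; first by apply: cvgM; [exact: cvg_id|exact: cvg_cst].
rewrite (_ : (fun r => _) = (fun r => - - hk d s (r ^+ 2))); last first.
  by apply/funext => r; rewrite opprK.
rewrite -[X in _ --> X]opprK; apply: cvgN.
exact: (is_derive_continuous (is_derive_hk_rho rho s0)).
Qed.

(** The fundamental solution as a function of the distance. *)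
Definition radial_pot r : R :=
  if d == 2%N then (2 * pi)^-1 * ln r
  else - ((d - 2)%:R * s_d d)^-1 * (r ^+ (d - 2))^-1.

(** Here the two cases of the definition meet: the derivative is r^(1-d) / s_d,
the value of [s_d] in the plane being 2 pi. *)
Lemma is_derive_radial_pot r : 0 < r ->
  is_derive r 1 radial_pot (fine (flux d) * (r / r ^+ d)).
Proof.
move=> r0; rewrite /radial_pot; have [dE|dn2] := eqVneq d 2%N.
  rewrite dE flux2/=.
  have := is_deriveZ (2 * pi : R)^-1 (is_derive1_ln r0).
  move=> h; apply: (is_derive_eq h); rewrite /GRing.scale/=; congr (_ * _).
  by field; rewrite gt_eqF.
have [k dk] : exists k, d = k.+3.
  by exists d.-1.-2; move: d2 dn2; case: d => [|[|[|]]].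
rewrite -s_dV (_ : (d - 2 = k.+1)%N); last by rewrite dk.
have rk0 : r ^+ k.+1 != 0 by rewrite expf_neq0// gt_eqF.
have hX : is_derive r 1 (fun x : R => x ^+ k.+1) (k.+1%:R * r ^+ k).
  rewrite (_ : (fun x : R => x ^+ k.+1) = (id : R -> R) ^+ k.+1); last first.
    by apply/funext => x; rewrite exprfctE.
  apply: (is_derive_eq (is_deriveX k.+1 (is_derive_id r (1 : R)))).
  by rewrite /GRing.scale/= mulr1.
have := is_deriveZ (- (k.+1%:R * s_d d)^-1 : R) (is_deriveV (rk0 : (fun x : R => x ^+ k.+1) r != 0) hX).
move=> h; apply: (is_derive_eq h); rewrite /GRing.scale/=.
have sd0 : s_d d != 0 :> R by rewrite -invr_eq0 s_dV gt_eqF// flux_gt0.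
have -> : r ^+ d = r * (r * (r * r ^+ k)) by rewrite dk !exprS.
rewrite !exprS expr0.
have k0 : k.+1%:R != 0 :> R by rewrite pnatr_eq0.
move: (k.+1%:R : R) k0 (s_d d : R) sd0 => a a0 b b0.
by field; rewrite a0 b0 expf_neq0 ?gt_eqF.
Qed.

Lemma measurable_hk_flux : measurable_fun setT
  (fun z : measurableTypeR R * measurableTypeR R => z.2 / (2 * z.1) * hk d z.1 (z.2 ^+ 2)).
Proof.
apply: measurable_funM.
  apply: measurable_funM => //; apply: (measurableT_comp (@measurable_inv R)).
  exact: measurable_funM.
by apply: measurable_hk => //; exact: measurable_funX.
Qed.

(** Both sides are the integral over u in [r, r'] of the heat flux at distance u,
taken over all times: on the left the flux is integrated in u first, on the right in s first. *)
Lemma integral_hk_diff r r' : 0 < r -> r <= r' ->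
  (\int[leb]_s (if 0 < s then hk d s (r ^+ 2) - hk d s (r' ^+ 2) else 0)%:E =
   (radial_pot r' - radial_pot r)%:E)%E.
Proof.
move=> r0 rr'.
pose f (z : measurableTypeR R * measurableTypeR R) : \bar R :=
  (if (0 < z.1) && (r <= z.2 <= r') then z.2 / (2 * z.1) * hk d z.1 (z.2 ^+ 2) else 0)%:E.
have mf : measurable_fun setT f.
  apply/measurable_EFinP; apply: measurable_fun_ifT => //.
    apply: measurable_and; first exact: measurable_fun_ltr.
    by apply: measurable_and; exact: measurable_fun_ler.
  exact: measurable_hk_flux.
have f0 z : (0 <= f z)%E.
  rewrite lee_fin; case: ifP => // /and3P[s0 rz _].
  have z0 := lt_le_trans r0 rz.
  by rewrite mulr_ge0 ?hk_ge0// divr_ge0// ?mulr_ge0// ltW.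
have setE : [set x : R | r <= x <= r'] = `[r, r']%classic.
  by apply/seteqP; split=> x /=; rewrite in_itv/=.
transitivity (\int[leb]_s \int[leb]_u f (s, u))%E.
  apply: eq_integral => s _; rewrite /f/=; case: ifPn => s0/=; last by rewrite integral0.
  rewrite integral_if setE [RHS](integral_itvcc_derive (F := fun r => - hk d s (r ^+ 2)))//.
  - by rewrite opprK addrC.
  - by move=> x _; exact: is_derive_hk_rho.
  - by move=> x _; exact: continuous_hk_flux.
rewrite (fubini_tonelli f)//.
transitivity (\int[leb]_u (if r <= u <= r' then fine (flux d) * (u / u ^+ d) else 0)%:E)%E.
  apply: eq_integral => u _; rewrite /f/=; case: ifPn => [/andP[ru _]|ru].
    rewrite -flux_scale ?(lt_le_trans r0)//.
    by apply: eq_integral => s _; rewrite andbT.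
  by under eq_integral do rewrite andbF; rewrite integral0.
rewrite integral_if setE; apply: integral_itvcc_derive => // x /andP[rx _].
  by apply: is_derive_radial_pot; exact: lt_le_trans rx.
have x0 := lt_le_trans r0 rx.
apply: cvgM; first exact: cvg_cst.
apply: cvgM; first exact: cvg_id.
by apply: cvgV; [rewrite expf_neq0// gt_eqF|exact: exprn_continuous].
Qed.

End radial_potential.

(** * Bounds on the heat kernel *)

Section heat_bounds.
Context {R : realType}.
Local Notation leb := (@lebesgue_measure R).
Variable d : nat.
Hypothesis d2 : (2 <= d)%N.
Implicit Types (s t q sg : R).

Let r0 : (0 : R) < d%:R / 2.
Proof. by rewrite divr_gt0// ltr0n (leq_trans _ d2). Qed.

Let p0 : (0 : R) < pi. Proof. exact: pi_gt0. Qed.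

Lemma hk_le s s' q : 0 < s -> s <= s' -> 0 <= q -> hk d s' q <= hk d s 0.
Proof.
move=> s0 ss' q0; have s'0 := lt_le_trans s0 ss'.
rewrite /hk mul0r oppr0 expR0 mulr1.
apply: (@le_trans _ _ ((4 * pi * s') `^ (d%:R / 2))^-1).
  rewrite ler_piMr ?invr_ge0 ?powR_ge0// expR_le1 oppr_le0.
  by rewrite divr_ge0// mulr_ge0// ltW.
rewrite lef_pV2 ?posrE ?powR_gt0 ?mulr_gt0//.
by apply: (ge0_ler_powR (ltW r0)); rewrite ?nnegrE ?mulr_ge0 ?ler_pM2l ?mulr_gt0// ltW.
Qed.

Lemma hk0_le s : 1 <= s -> hk d s 0 <= s^-1.
Proof.
move=> s1; have s0 := lt_le_trans ltr01 s1.
rewrite /hk mul0r oppr0 expR0 mulr1 lef_pV2 ?posrE ?powR_gt0 ?mulr_gt0//.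
have h : s <= 4 * pi * s.
  by rewrite ler_peMl// ?ltW//; have := @pi_ge2 R; lra.
apply: (le_trans h); rewrite -[leLHS]powRr1 ?mulr_ge0 ?(ltW s0) ?(ltW p0)//.
apply: ler_powR; first by rewrite (le_trans s1).
by rewrite ler_pdivlMr// mul1r ler_nat.
Qed.

(** The inequality (1 + sg / s)^(d/2) <= exp (d sg / (2 s)) bounds the loss from
the prefactor, and exp (- q / (4 s)) the loss from the Gaussian factor; the
product of the two exponentials is then bounded below by 1 - x <= exp (- x). *)
Lemma hk_ge s sg q : 0 < s -> 0 <= sg -> 0 <= q ->
  hk d s 0 * (1 - (d%:R / 2 * sg + q / 4) / s) <= hk d (s + sg) q.
Proof.
move=> s0 sg0 q0; have ssg0 : 0 < s + sg by rewrite ltr_wpDr.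
apply: (@le_trans _ _ (hk d s 0 * expR (- ((d%:R / 2 * sg + q / 4) / s)))).
  by rewrite ler_wpM2l ?hk_ge0// expR_ge1Dx.
have -> : - ((d%:R / 2 * sg + q / 4) / s) =
    - (d%:R / 2 * sg / s) + - (q / 4 / s) by rewrite mulrDl opprD.
rewrite /hk mul0r oppr0 expR0 mulr1 expRD mulrA.
apply: ler_pM; rewrite ?mulr_ge0 ?invr_ge0 ?powR_ge0 ?expR_ge0//; last first.
  rewrite ler_expR lerN2 -mulrA ler_wpM2l// -invfM lef_pV2 ?posrE ?mulr_gt0//.
  by rewrite ler_pM2l// lerDl.
rewrite expRN -invfM lef_pV2 ?posrE ?mulr_gt0 ?powR_gt0 ?expR_gt0 ?mulr_gt0//.
rewrite (_ : 4 * pi * (s + sg) = (4 * pi * s) * (1 + sg / s)); last first.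
  by field; rewrite gt_eqF.
have h1 : 0 <= 4 * pi * s by rewrite !mulr_ge0// ltW.
have h2 : 0 <= 1 + sg / s by rewrite addr_ge0// divr_ge0// ltW.
rewrite (powRM _ h1 h2).
rewrite ler_pM2l ?powR_gt0 ?mulr_gt0//.
rewrite (_ : d%:R / 2 * sg / s = sg / s * (d%:R / 2)); last by ring.
rewrite expRM; apply: (ge0_ler_powR (ltW r0)); rewrite ?nnegrE ?expR_ge0//.
exact: expR_ge1Dx.
Qed.

(** The decay s^(-2) makes the regularized potential converge in dimension 2 as
well, where p_s itself decays only like 1 / s. *)
Lemma hk_diff_le s sg q : 1 <= s -> 0 <= sg -> 0 <= q ->
  hk d s 0 - hk d (s + sg) q <= (d%:R / 2 * sg + q / 4) * (s ^+ 2)^-1.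
Proof.
move=> s1 sg0 q0; have s0 := lt_le_trans ltr01 s1.
rewrite lerBlDr -lerBlDl; apply: le_trans (hk_ge s0 sg0 q0).
rewrite mulrBr mulr1 lerD2l lerN2 mulrCA; apply: ler_wpM2l.
  by rewrite addr_ge0// ?divr_ge0// mulr_ge0// ltW.
by rewrite expr2 invfM ler_pM2r ?invr_gt0// hk0_le.
Qed.

Lemma integral_sqrV_tail a : 0 < a ->
  (\int[leb]_s (if a <= s then (s ^+ 2)^-1 else 0)%:E = (a^-1)%:E)%E.
Proof.
move=> a0; rewrite integral_if.
rewrite (_ : [set s : R | _] = `[a, +oo[%classic); last first.
  by apply/seteqP; split=> x /=; rewrite in_itv/= andbT.
have gt0a x : a <= x -> 0 < x by exact: lt_le_trans.
rewrite -[a^-1]opprK -[X in X%:E]add0r.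
apply: (@ge0_integral_itvcy_derive _ _ (fun x => - x^-1)).
- by move=> x _; rewrite invr_ge0 sqr_ge0.
- move=> x /gt0a x0; have xn0 : (id : R -> R) x != 0 by rewrite gt_eqF.
  have := is_deriveN (is_deriveV xn0 (is_derive_id x (1 : R))).
  move=> h; apply: (is_derive_eq h).
  by rewrite /GRing.scale/= mulr1 opprK.
- move=> x /gt0a x0; apply: cvgV; first by rewrite expf_neq0// gt_eqF.
  exact: exprn_continuous.
- rewrite -oppr0; apply: cvgN.
  by apply/gtr0_cvgV0; [near=> x|exact: cvg_id].
Unshelve. all: by end_near. Qed.

End heat_bounds.

(** * The regularized potential and its convolution *)

Section defect.
Context {R : realType}.
Local Notation leb := (@lebesgue_measure R).
Variable d : nat.
Hypothesis d2 : (2 <= d)%N.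
Implicit Types (s t q sg : R).

(** Minus the heat kernel at time s + sg, compensated from s = 1 on by the value
of p_s at the origin.  Its sign depends only on whether s >= 1 ([defect_ge0],
[defect_le0]). *)
Definition defect sg q s : R :=
  (if 1 <= s then hk d s 0 else 0) - (if 0 < s then hk d (s + sg) q else 0).

Lemma defect_ge0 sg q s : 0 <= sg -> 0 <= q -> 1 <= s -> 0 <= defect sg q s.
Proof.
move=> sg0 q0 s1; have s0 := lt_le_trans ltr01 s1.
by rewrite /defect s1 s0 subr_ge0 hk_le// lerDl.
Qed.

Lemma defect_le0 sg q s : s < 1 -> defect sg q s <= 0.
Proof.
by rewrite /defect ltNge => /negbTE ->; rewrite sub0r oppr_le0; case: ifP => // _; exact: hk_ge0.
Qed.

Lemma measurable_defect disp (T : measurableType disp) sg (f g : T -> R) :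
  measurable_fun setT f -> measurable_fun setT g ->
  measurable_fun setT (fun z => defect sg (g z) (f z)).
Proof.
move=> mf mg; apply: measurable_funB; apply: measurable_fun_ifT => //.
- exact: measurable_fun_ler.
- exact: measurable_hk.
- exact: measurable_fun_ltr.
- by apply: measurable_hk => //; exact: measurable_funD.
Qed.

Let measurable_hk01 sg q :
  measurable_fun setT (fun s => if 0 < s <= 1 then hk d (s + sg) q else 0).
Proof.
apply: measurable_fun_ifT => //.
  by apply: measurable_and; [apply: measurable_fun_ltr|apply: measurable_fun_ler].
by apply: measurable_hk => //; exact: measurable_funD.
Qed.

Let hk01_ge0 sg q s : 0 <= (if 0 < s <= 1 then hk d (s + sg) q else 0).
Proof. by case: ifP => // _; exact: hk_ge0. Qed.

(** For sg > 0 the integrand is bounded.  For sg = 0 and q = rho^2 > 0 it is at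
most 2 / rho times the heat flux at distance rho, as 1 / s >= 1, and the total
flux is finite. *)
Lemma integral_hk01_lty sg q : 0 <= sg -> 0 <= q -> (0 < sg) || (0 < q) ->
  (\int[leb]_s (if 0 < s <= 1 then hk d (s + sg) q else 0)%:E < +oo)%E.
Proof.
move=> sg0 q0 sgq; have [sg0'|sg0'] := ltP 0 sg.
  apply: (@le_lt_trans _ _ (\int[leb]_s ((hk d sg 0)%:E * (\1_`]0, 1] s)%:E))%E).
    apply: ge0_le_integral => //.
    - by move=> s _; rewrite lee_fin.
    - by apply/measurable_EFinP; exact: measurable_hk01.
    - apply: emeasurable_funM => //; apply/measurable_EFinP.
      exact: measurable_indic.
    - move=> s _; rewrite -EFinM lee_fin indicE mem_setE in_itv/=.
      case: ifP => s01; last by rewrite mulr0.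
      by rewrite mulr1 hk_le// lerDr; case/andP: s01 => /ltW.
  rewrite ge0_integralZl//; last first.
  - by rewrite lee_fin hk_ge0.
  - by apply/measurable_EFinP; exact: measurable_indic.
  rewrite integral_indic// setIT.
  have /= -> := lebesgue_measure_itv `]0%R, (1 : R)].
  by rewrite lte_fin ltr01 -EFinB -EFinM ltry.
have sgE : sg = 0 by apply/eqP; rewrite eq_le sg0 sg0'.
have q_gt0 : 0 < q by move: sgq; rewrite sgE ltxx.
pose rho := Num.sqrt q; have rho0 : 0 < rho by rewrite sqrtr_gt0.
have qE : rho ^+ 2 = q by rewrite sqr_sqrtr// ltW.
apply: (@le_lt_trans _ _ ((2 / rho)%:E * \int[leb]_s
    (if 0 < s then rho / (2 * s) * hk d s (rho ^+ 2) else 0)%:E)%E); last first.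
  by rewrite flux_scale// -EFinM ltry.
have f0 s : 0 < s -> 0 <= rho / (2 * s) * hk d s (rho ^+ 2).
  by move=> s0; rewrite mulr_ge0 ?hk_ge0// divr_ge0 ?mulr_ge0// ltW.
have mf : measurable_fun setT (fun s => rho / (2 * s) * hk d s (rho ^+ 2)).
  apply: measurable_funM; last exact: measurable_hk.
  apply: measurable_funM => //; apply: (measurableT_comp (@measurable_inv R)).
  exact: measurable_funM.
rewrite -integral_ifZ//; last 2 first.
- by rewrite divr_ge0// ltW.
- exact: measurable_fun_ltr.
apply: ge0_le_integral => //.
- by move=> s _; rewrite lee_fin.
- by apply/measurable_EFinP; exact: measurable_hk01.
- apply/measurable_EFinP; apply: measurable_fun_ifT => //.
    exact: measurable_fun_ltr.
  exact: measurable_funM.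
- move=> s _; rewrite lee_fin sgE addr0 qE; case: ifPn => [/andP[s0 s1]|_]; last first.
    case: ifP => // s0; rewrite mulr_ge0 ?divr_ge0 ?(ltW rho0)//.
    by rewrite -qE f0.
  rewrite s0 mulrA (_ : 2 / rho * (rho / (2 * s)) = s^-1); last first.
    by field; rewrite !gt_eqF.
  by rewrite ler_peMl ?hk_ge0// invf_ge1.
Qed.

Lemma integrable_defect sg q : 0 <= sg -> 0 <= q -> (0 < sg) || (0 < q) ->
  leb.-integrable setT (fun s => (defect sg q s)%:E).
Proof.
move=> sg0 q0 sgq.
pose K := d%:R / 2 * sg + q / 4.
have K0 : 0 <= K by rewrite addr_ge0 ?mulr_ge0 ?divr_ge0.
have mtail : measurable_fun setT (fun s : R => if 1 <= s then (s ^+ 2)^-1 else 0).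
  apply: measurable_fun_ifT => //; first exact: measurable_fun_ler.
  by apply: (measurableT_comp (@measurable_inv R)); exact: measurable_funX.
have tail0 s : 0 <= (if 1 <= s then (s ^+ 2)^-1 else 0).
  by case: ifP => // _; rewrite invr_ge0 sqr_ge0.
apply/integrableP; split.
  by apply/measurable_EFinP; exact: measurable_defect.
apply: (@le_lt_trans _ _ (\int[leb]_s
   ((if 0 < s <= 1 then hk d (s + sg) q else 0)%:E +
    K%:E * (if 1 <= s then (s ^+ 2)^-1 else 0)%:E))%E).
  apply: ge0_le_integral => //.
  - apply/measurable_EFinP; apply: measurableT_comp => //.
    exact: measurable_defect.
  - apply: emeasurable_funD.
      by apply/measurable_EFinP; exact: measurable_hk01.
    by apply: emeasurable_funM => //; exact/measurable_EFinP.
  - move=> s _; rewrite -EFinM -EFinD abse_EFin lee_fin.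
    have [s1|s1] := leP 1 s.
      rewrite ger0_norm ?defect_ge0//; apply: ler_wpDl => //.
      by rewrite /defect s1 (lt_le_trans ltr01 s1); exact: hk_diff_le.
    rewrite ler0_norm ?defect_le0// mulr0 addr0 /defect (leNgt 1 s) s1/= sub0r opprK.
    by rewrite (ltW s1) andbT.
rewrite ge0_integralD//; last 4 first.
- by move=> s _; rewrite lee_fin.
- by apply/measurable_EFinP; exact: measurable_hk01.
- by move=> s _; rewrite -EFinM lee_fin mulr_ge0.
- by apply: emeasurable_funM => //; exact/measurable_EFinP.
rewrite lte_add_pinfty ?integral_hk01_lty// ge0_integralZl//; last first.
- by move=> s _; rewrite lee_fin.
- exact/measurable_EFinP.
- by rewrite integral_sqrV_tail// -EFinM ltry.
Qed.

End defect.

Section potential.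
Context {R : realType}.
Local Notation leb := (@lebesgue_measure R).
Variable d : nat.
Hypothesis d2 : (2 <= d)%N.
Implicit Types (s t q sg tau : R) (x y w : 'rV[R]_d).

Definition Psi_cst : R := @radial_pot R d 1 - \int[leb]_s defect d 0 1 s.

(** The fundamental solution convolved with the heat kernel at time sg, as a
function of the squared distance ([Psi0E], [Psi_conv]); the constant is fixed
by the value at distance 1. *)
Definition Psi sg q : R := Psi_cst + \int[leb]_s defect d sg q s.

Lemma fund_solE (x y : 'rV[R]_d) : fund_sol x y = radial_pot d (enorm (x - y)).
Proof. by []. Qed.

Let Rintegral_hk_diff r r' : 0 < r -> r <= r' ->
  \int[leb]_s defect d 0 (r' ^+ 2) s - \int[leb]_s defect d 0 (r ^+ 2) s =
  radial_pot d r' - radial_pot d r :> R.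
Proof.
move=> r0 rr'; have r'0 := lt_le_trans r0 rr'.
rewrite -RintegralB//; last 2 first.
- by apply: integrable_defect; rewrite ?sqr_ge0 ?exprn_gt0 ?orbT.
- by apply: integrable_defect; rewrite ?sqr_ge0 ?exprn_gt0 ?orbT.
have := integral_hk_diff d2 r0 rr'; rewrite /Rintegral => h.
rewrite [X in fine X](_ : _ = (radial_pot d r' - radial_pot d r)%:E)// -h.
apply: eq_integral => s _; congr EFin; rewrite /defect addr0.
by case: ifP; case: ifP => _ _; ring.
Qed.

Lemma Psi0E r : 0 < r -> Psi 0 (r ^+ 2) = radial_pot d r.
Proof.
move=> r0; rewrite /Psi /Psi_cst.
have [r1|r1] := leP r 1.
  have := Rintegral_hk_diff r0 r1; rewrite expr1n; lra.
have := Rintegral_hk_diff ltr01 (ltW r1); rewrite expr1n; lra.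
Qed.

Section convolution.
Variables (sg tau : R) (x y : 'rV[R]_d).
Hypotheses (sg0 : 0 <= sg) (tau0 : 0 < tau).

Let k w := hk d tau (sqn (w - y)).
Let k0 w : 0 <= k w. Proof. exact: hk_ge0. Qed.
Let mk : measurable_fun setT k. Proof. exact: measurable_hk_sqn. Qed.

Let D (z : 'rV[R]_d * measurableTypeR R) := defect d sg (sqn (z.1 - x)) z.2 * k z.1.

Let mD : measurable_fun setT D.
Proof.
apply: measurable_funM; last exact: (measurableT_comp mk).
apply: measurable_defect => //.
exact: (measurableT_comp (@measurable_sqnB R d x)).
Qed.

Let A s w := (if 1 <= s then hk d s 0 else 0) * k w.
Let B s w := (if 0 < s then hk d (s + sg) (sqn (w - x)) else 0) * k w.

Let A0 s w : 0 <= A s w.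
Proof. by rewrite mulr_ge0//; case: ifP => // _; exact: hk_ge0. Qed.

Let B0 s w : 0 <= B s w.
Proof. by rewrite mulr_ge0//; case: ifP => // _; exact: hk_ge0. Qed.

Let mA s : measurable_fun setT (A s). Proof. by apply: measurable_funM. Qed.

Let mB s : measurable_fun setT (B s).
Proof.
by apply: measurable_funM => //; case: (0 < s) => //; exact: measurable_hk_sqn.
Qed.

Let intA s : (\int[lebesgue_rV d]_w (A s w)%:E = (if 1 <= s then hk d s 0 else 0)%:E)%E.
Proof.
transitivity (\int[lebesgue_rV d]_w ((if 1 <= s then hk d s 0 else 0)%:E * (k w)%:E))%E.
  by apply: eq_integral => w _; rewrite -EFinM.
rewrite ge0_integralZl//.
- by rewrite integral_hk// mule1.
- exact/measurable_EFinP.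
- by move=> w _; rewrite lee_fin.
- by rewrite lee_fin; case: ifP => // _; exact: hk_ge0.
Qed.

Let intB s : (\int[lebesgue_rV d]_w (B s w)%:E =
  (if (0 < s)%R then hk d (s + (sg + tau)) (sqn (x - y)) else 0)%:E)%E.
Proof.
rewrite /B; case: ifPn => s0; last first.
  by under eq_integral do rewrite mul0r; rewrite integral0.
by rewrite integral_hk_conv ?ltr_wpDr// addrA.
Qed.

Let integrableA s : (lebesgue_rV d).-integrable setT (EFin \o A s).
Proof.
apply/integrableP; split; first exact/measurable_EFinP.
under eq_integral => w _ do rewrite /= ger0_norm//.
by rewrite intA ltry.
Qed.

Let integrableB s : (lebesgue_rV d).-integrable setT (EFin \o B s).
Proof.
apply/integrableP; split; first exact/measurable_EFinP.
under eq_integral => w _ do rewrite /= ger0_norm//.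
by rewrite intB ltry.
Qed.

(** The semigroup property moves the time from sg to sg + tau, and the
compensating term, constant in w, is preserved because the heat kernel has
mass 1. *)
Lemma integral_defect_conv s :
  (\int[lebesgue_rV d]_w (D (w, s))%:E = (defect d (sg + tau) (sqn (x - y)) s)%:E)%E.
Proof.
rewrite /defect EFinB -intA -intB -integralB_EFin//.
by apply: eq_integral => w _; rewrite -EFinB -mulrBl.
Qed.

(** The sign of the defect depends on s alone, so absolute values pass through
the convolution; this gives the integrability required by Fubini. *)
Let integral_abs_defect_conv s :
  (\int[lebesgue_rV d]_w `|(D (w, s))%:E| =
   `|(defect d (sg + tau) (sqn (x - y)) s)%:E|)%E.
Proof.
have mDs : measurable_fun setT (fun w => (D (w, s))%:E).
  apply/measurable_EFinP.
  exact: (@measurable_fun_pair1 _ _ _ _ _ _ D s mD).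
have st0 : 0 <= sg + tau by rewrite addr_ge0// ltW.
have [s1|s1] := leP 1 s.
  rewrite gee0_abs ?lee_fin ?defect_ge0 ?sqn_ge0// -integral_defect_conv.
  apply: eq_integral => w _; rewrite gee0_abs// lee_fin mulr_ge0//.
  by rewrite defect_ge0 ?sqn_ge0.
rewrite lee0_abs ?lee_fin ?defect_le0// -EFinN opprB EFinB -intA -intB.
rewrite -integralB_EFin//; apply: eq_integral => w _.
rewrite lee0_abs ?lee_fin ?mulr_le0_ge0 ?defect_le0//.
by rewrite -EFinN -EFinB /A /B -mulrBl -mulNr opprB.
Qed.

Let integrableD12 : (lebesgue_rV d \x leb)%E.-integrable setT (EFin \o D).
Proof.
apply/integrable21ltyP; first exact/measurable_EFinP.
under eq_integral do rewrite integral_abs_defect_conv.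
have st0 : 0 < sg + tau by rewrite ltr_wpDl.
have := @integrable_defect R d d2 (sg + tau) (sqn (x - y)) (ltW st0) (sqn_ge0 _).
by rewrite st0 => /(_ isT) /integrableP[].
Qed.

Lemma integrable_defect_conv : (lebesgue_rV d).-integrable setT
  (fun w => \int[leb]_s (D (w, s))%:E)%E.
Proof. exact: (integrable_fubini_F integrableD12). Qed.

Lemma integral_integral_defect_conv :
  (\int[lebesgue_rV d]_w \int[leb]_s (D (w, s))%:E =
   \int[leb]_s (defect d (sg + tau) (sqn (x - y)) s)%:E)%E.
Proof.
rewrite (Fubini integrableD12).
by apply: eq_integral => s _; exact: integral_defect_conv.
Qed.

Let integral_defect_k w : (0 < sg) || (w != x) ->
  (\int[leb]_s (D (w, s))%:E = ((\int[leb]_s defect d sg (sqn (w - x)) s)%R * k w)%:E)%E.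
Proof.
move=> wx.
have h : leb.-integrable setT (fun s => (defect d sg (sqn (w - x)) s)%:E).
  by apply: integrable_defect => //; rewrite ?sqn_ge0// sqn_gt0 subr_eq0.
transitivity (\int[leb]_s ((defect d sg (sqn (w - x)) s)%:E * (k w)%:E))%E.
  by apply: eq_integral => s _; rewrite -EFinM.
by rewrite integralZr// EFinM fineK//; apply: integrable_fin_num.
Qed.

Lemma integrable_hk_sqn : (lebesgue_rV d).-integrable setT (fun w => (k w)%:E).
Proof.
apply/integrableP; split; first exact/measurable_EFinP.
under eq_integral => w _ do rewrite /= ger0_norm//.
by rewrite integral_hk// ltry.
Qed.

(** The integrand Psi_sg(w - x) p_tau(w - y), extended to w = x by whatever value
its integral over s takes there. *)
Let E (w : 'rV[R]_d) : \bar R := (Psi_cst%:E * (k w)%:E + \int[leb]_s (D (w, s))%:E)%E.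

Let integrable_E : (lebesgue_rV d).-integrable setT E.
Proof.
apply: integrableD => //; last exact: integrable_defect_conv.
by apply: integrableZl => //; exact: integrable_hk_sqn.
Qed.

Let integral_E : (\int[lebesgue_rV d]_w E w = (Psi (sg + tau) (sqn (x - y)))%:E)%E.
Proof.
rewrite integralD//; last 2 first.
- by apply: integrableZl => //; exact: integrable_hk_sqn.
- exact: integrable_defect_conv.
rewrite integralZl//; last exact: integrable_hk_sqn.
rewrite integral_hk// mule1 integral_integral_defect_conv /Psi /Rintegral.
rewrite [in RHS]EFinD fineK//.
apply: integrable_fin_num => //; apply: integrable_defect; rewrite ?sqn_ge0//.
  by rewrite addr_ge0// ltW.
by rewrite ltr_wpDl.
Qed.

(** Measurability is inherited from Fubini, after division by the positive heat
kernel. *)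
Lemma measurable_Psi_sqn : 0 < sg ->
  measurable_fun setT (fun w => Psi sg (sqn (w - x))).
Proof.
move=> sg_gt0; have mE := measurable_int _ integrable_E.
rewrite (_ : (fun w => _) = (fun w => fine (E w) * (k w)^-1)).
  apply: measurable_funM; first exact: measurableT_comp.
  exact: (measurableT_comp (@measurable_inv R)).
apply/funext => w; rewrite /E integral_defect_k ?sg_gt0// -EFinM -EFinD -mulrDl/=.
by rewrite mulfK// gt_eqF// hk_gt0.
Qed.

(** For sg = 0 the function H is only prescribed off the null set {x}; this is how
the fundamental solution, singular at x, enters. *)
Lemma Psi_conv (H : 'rV[R]_d -> R) :
  measurable_fun setT H ->
  (forall w, (0 < sg) || (w != x) -> H w = Psi sg (sqn (w - x))) ->
  (lebesgue_rV d).-integrable setT (fun w => (H w * k w)%:E) /\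
  (\int[lebesgue_rV d]_w (H w * k w)%:E = (Psi (sg + tau) (sqn (x - y)))%:E)%E.
Proof.
move=> mH HE.
have mHk : measurable_fun setT (fun w => (H w * k w)%:E).
  by apply/measurable_EFinP; exact: measurable_funM.
have HkE w : (0 < sg) || (w != x) -> (H w * k w)%:E = E w.
  by move=> h; rewrite /E integral_defect_k// HE// -EFinM -EFinD -mulrDl.
have ae : ae_eq (lebesgue_rV d) setT (fun w => (H w * k w)%:E) E.
  exists [set x]; split; first exact: measurable_rV_set1.
    by case: d d2 x => // n _ u; exact: lebesgue_rV_set1.
  move=> w /= /existsNP[_]; apply: contra_notP => /eqP wx.
  by apply: HkE; rewrite wx orbT.
have mE := measurable_int _ integrable_E.
split; last by rewrite (ae_eq_integral E).
apply/integrableP; split => //.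
rewrite (ae_eq_integral (abse \o E))//.
- by have /integrableP[] := integrable_E.
- exact: measurableT_comp.
- exact: measurableT_comp.
- exact: (ae_eq_comp abse ae).
Qed.

End convolution.
End potential.

(** * The energies A_d and C_d *)

Section energies.
Context {R : realType}.
Variable d : nat.
Hypothesis d2 : (2 <= d)%N.
Implicit Types (t c tau : R).

Lemma integral_lincomb disp (T : measurableType disp)
    (mu : {measure set T -> \bar R}) n (c : R) (f : 'I_n -> T -> R) (L : 'I_n -> R) :
  (forall j, mu.-integrable setT (fun v => (f j v)%:E)) ->
  (forall j, \int[mu]_v (f j v)%:E = (L j)%:E)%E ->
  mu.-integrable setT (fun v => (c * \sum_(j < n) f j v)%:E) /\
  (\int[mu]_v (c * \sum_(j < n) f j v)%:E = (c * \sum_(j < n) L j)%:E)%E.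
Proof.
move=> intf fL.
have E : (fun v => (c * \sum_(j < n) f j v)%:E) =
    (fun v => c%:E * \sum_(j < n) (f j v)%:E)%E.
  by apply/funext => v; rewrite EFinM sumEFin.
have i1 : mu.-integrable setT (fun v => \sum_(j < n) (f j v)%:E)%E.
  exact: integrable_sum.
rewrite E; split; first exact: integrableZl.
rewrite integralZl// integral_sum// EFinM -sumEFin.
by congr (_ * _)%E; apply: eq_bigr => j _; exact: fL.
Qed.

Lemma measurable_radial_pot : measurable_fun setT (@radial_pot R d).
Proof.
rewrite /radial_pot; case: (d == 2%N).
  by apply: measurable_funM => //; exact: measurable_ln.
apply: measurable_funM => //; apply: (measurableT_comp (@measurable_inv R)).
exact: measurable_funX.
Qed.

Lemma fund_sol_conv t (u y : 'rV[R]_d) : 0 < t ->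
  (lebesgue_rV d).-integrable setT (fun v => (fund_sol u v * heat_kernel t y v)%:E) /\
  (\int[lebesgue_rV d]_v (fund_sol u v * heat_kernel t y v)%:E =
   (Psi d t (sqn (u - y)))%:E)%E.
Proof.
move=> t0.
have mH : measurable_fun setT (fund_sol u).
  rewrite (_ : fund_sol u = (fun v => radial_pot d (enorm (v - u)))).
    exact: (measurableT_comp measurable_radial_pot (measurable_enormB u)).
  by apply/funext => v; rewrite fund_solE enormBC.
have E : (fun v => (fund_sol u v * heat_kernel t y v)%:E) =
    (fun v => (fund_sol u v * hk d t (sqn (v - y)))%:E).
  by apply/funext => v; rewrite heat_kernelE.
rewrite E (_ : Psi d t _ = Psi d (0 + t) (sqn (u - y))); last by rewrite add0r.
apply: (Psi_conv d2 _ (lexx 0) t0 mH) => w.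
rewrite ltxx/= => wu; rewrite fund_solE enormBC -sqr_enorm Psi0E//.
by rewrite lt_neqAle enorm_ge0 eq_sym enorm_eq0 subr_eq0 wu.
Qed.

Lemma C_dE t : 0 < t -> C_d d t = Psi d t 0 :> R.
Proof.
move=> t0; have [_ h] := @fund_sol_conv t 0 0 t0.
by rewrite /C_d /Rintegral h subr0 sqn0.
Qed.

(** The inner integral convolves G with the heat kernel at time t/2, which gives
Psi at time t/2; the outer one convolves once more, up to time t. *)
Lemma A_dE N (x : 'I_N -> 'rV[R]_d) t : 0 < t ->
  A_d x t = (N%:R ^+ 2)^-1 * \sum_(i < N) \sum_(j < N) Psi d t (sqn (x i - x j)).
Proof.
move=> t0; have th0 : 0 < t / 2 by rewrite divr_gt0.
have inner u : \int[lebesgue_rV d]_v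
    (fund_sol u v * heat_empirical x (t / 2) u * heat_empirical x (t / 2) v) =
    (N%:R^-1 * heat_empirical x (t / 2) u) * \sum_(j < N) Psi d (t / 2) (sqn (u - x j)).
  have [_ h] := @integral_lincomb _ _ (lebesgue_rV d) N
    (N%:R^-1 * heat_empirical x (t / 2) u)
    (fun j v => fund_sol u v * heat_kernel (t / 2) (x j) v)
    (fun j => Psi d (t / 2) (sqn (u - x j)))
    (fun j => (fund_sol_conv u (x j) th0).1) (fun j => (fund_sol_conv u (x j) th0).2).
  rewrite /Rintegral -[RHS]/(fine (_%:E)) -h; congr fine.
  apply: eq_integral => v _; congr EFin.
  rewrite [heat_empirical x _ v]/heat_empirical -[in RHS]mulr_sumr.
  by rewrite mulrACA mulrA [in RHS]mulrA; congr (_ * _); ring.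
rewrite /A_d.
transitivity (\int[lebesgue_rV d]_u ((N%:R ^+ 2)^-1 *
   \sum_(j < N) (1 * \sum_(i < N) Psi d (t / 2) (sqn (u - x j)) * heat_kernel (t / 2) (x i) u))).
  apply: eq_Rintegral => u _; rewrite inner /heat_empirical expr2 invfM -!mulrA.
  congr (_ * (_ * _)); rewrite mulrC mulr_suml; apply: eq_bigr => j _.
  by rewrite mul1r mulr_sumr.
have conv i j : (lebesgue_rV d).-integrable setT
      (fun u => (Psi d (t / 2) (sqn (u - x j)) * heat_kernel (t / 2) (x i) u)%:E) /\
    (\int[lebesgue_rV d]_u
      (Psi d (t / 2) (sqn (u - x j)) * heat_kernel (t / 2) (x i) u)%:E =
      (Psi d t (sqn (x j - x i)))%:E)%E.
  have E : (fun u => (Psi d (t / 2) (sqn (u - x j)) * heat_kernel (t / 2) (x i) u)%:E) =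
    (fun u => (Psi d (t / 2) (sqn (u - x j)) * hk d (t / 2) (sqn (u - x i)))%:E).
    by apply/funext => v; rewrite heat_kernelE.
  rewrite E (_ : Psi d t _ = Psi d (t / 2 + t / 2) (sqn (x j - x i))); last first.
    by rewrite -splitr.
  apply: (Psi_conv d2 _ (ltW th0) th0) => //.
  by apply: (measurable_Psi_sqn d2 (x j) (x j) (ltW th0) ltr01 th0).
have inner2 j := @integral_lincomb _ _ (lebesgue_rV d) N 1
    (fun i u => Psi d (t / 2) (sqn (u - x j)) * heat_kernel (t / 2) (x i) u)
    (fun i => Psi d t (sqn (x j - x i))) (fun i => (conv i j).1) (fun i => (conv i j).2).
have [_ h] := @integral_lincomb _ _ (lebesgue_rV d) N (N%:R ^+ 2)^-1 _ _
   (fun j => (inner2 j).1) (fun j => (inner2 j).2).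
rewrite /Rintegral h/=; congr (_ * _); apply: eq_bigr => j _.
by rewrite mul1r.
Qed.

End energies.

(** * Growth of the potential along the heat flow *)

Section potential_growth.
Context {R : realType}.
Local Notation leb := (@lebesgue_measure R).
Variable d : nat.
Hypothesis d2 : (2 <= d)%N.
Implicit Types (s t q a b M S : R).

Lemma integrable_itv_bounded (f : R -> R) a b M :
  measurable_fun setT f -> (forall s, a < s <= b -> `|f s| <= M) ->
  leb.-integrable setT (fun s => (if a < s <= b then f s else 0)%:E).
Proof.
move=> mf fM.
have mg : measurable_fun setT (fun s => (if a < s <= b then f s else 0)%:E).
  apply/measurable_EFinP; apply: measurable_fun_ifT => //.
  by apply: measurable_and; [apply: measurable_fun_ltr|apply: measurable_fun_ler].
apply: (@le_integrable _ _ _ leb _ measurableT _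
  (fun s : measurableTypeR R => M%:E * (\1_`]a, b] s)%:E)%E) => //.
  move=> s _; rewrite -EFinM !abse_EFin lee_fin indicE mem_setE in_itv/=.
  case: ifPn => sab; last by rewrite normr0.
  by rewrite mulr1 (le_trans (fM _ sab))// ler_norm.
by apply: integrableZl => //; exact: integrable_indic_itv.
Qed.

(** With p_s for the heat kernel at q: up to S the first bracket is
p_s - p_(s+t), and beyond S it is at least minus the tail (q / 4) s^(-2); the terms
in p_(s+t) over (0, S] and p_s over (t, S + t] have the same integral, so that
integration leaves m on the left and errors of order 1 / S on the right. *)
Lemma growth_pointwise t q S s m : 0 < t -> 0 < q -> 1 <= S -> t <= S ->
  m <= (if 0 < s <= t then hk d s q else 0) ->
  m + (if t < s <= S + t then hk d s q else 0) <=
  (defect d t q s - defect d 0 q s) + (if 0 < s <= S then hk d (s + t) q else 0) +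
  (q / 4 * (if S <= s then (s ^+ 2)^-1 else 0) +
   (if S < s <= S + t then hk d S 0 else 0)).
Proof.
move=> t0 q0 S1 tS; have S0 := lt_le_trans ltr01 S1.
have -> : defect d t q s - defect d 0 q s =
    if 0 < s then hk d s q - hk d (s + t) q else 0.
  by rewrite /defect addr0; case: (0 < s); ring.
have tail0 : 0 <= q / 4 * (if S <= s then (s ^+ 2)^-1 else 0).
  by rewrite mulr_ge0 ?divr_ge0 ?(ltW q0)//; case: ifP => // _; rewrite invr_ge0 sqr_ge0.
have [s0|s0] := ltP 0 s; last first.
  rewrite /= [t < s]lt_neqAle [t <= s]leNgt (le_lt_trans s0 t0) andbF/=.
  rewrite [S < s]ltNge (le_trans s0 (ltW S0))/= !addr0 !add0r => m0.
  exact: le_trans tail0.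
have hs0 := hk_ge0 d s q; have hS := @hk_le R d d2 S s q S0.
have hst := @hk_le R d d2 s (s + t) q s0.
have hK := @hk_diff_le R d d2 s 0 q; rewrite mulr0 add0r addr0 in hK.
move: (hk d s q) (hk d (s + t) q) (hk d s 0) (hk d S 0) tail0 hs0 hS hst hK => h h' hs hS'.
have [sS|Ss] /= := leP s S => tail0 hs0 hS hst hK.
  have -> : s <= S + t by rewrite (le_trans sS)// lerDl ltW.
  by case: (leP s t) => _ /= mh; lra.
rewrite (ltW Ss) (le_lt_trans tS Ss)/= [s <= t]leNgt (le_lt_trans tS Ss)/= => m0.
have := hS (ltW Ss) (ltW q0).
have := hst; rewrite lerDl => /(_ (ltW t0) (ltW q0)) {}hst.
have := hK (le_trans S1 (ltW Ss)) (lexx 0) (ltW q0).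
by case: ifP => _; lra.
Qed.

(** Integration of [growth_pointwise].  The cut-off at S is needed because p_s
is not integrable at infinity in dimension 2. *)
Lemma Psi_growth_approx t q (m : R -> R) S : 0 < t -> 0 < q -> 1 <= S -> t <= S ->
  leb.-integrable setT (EFin \o m) ->
  (forall s, m s <= (if 0 < s <= t then hk d s q else 0)) ->
  \int[leb]_s m s <= Psi d t q - Psi d 0 q + (q / 4 + t) * S^-1.
Proof.
move=> t0 q0 S1 tS im mh; have S0 := lt_le_trans ltr01 S1.
pose e s := defect d t q s - defect d 0 q s.
pose h2 s := if 0 < s <= S then hk d (s + t) q else 0.
pose f s := if t < s <= S + t then hk d s q else 0.
pose tail s : R := if S <= s then (s ^+ 2)^-1 else 0.
pose ind s : R := if S < s <= S + t then hk d S 0 else 0.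
have ie : leb.-integrable setT (EFin \o e).
  have i1 : leb.-integrable setT (fun s => (defect d t q s)%:E).
    by apply: integrable_defect; rewrite ?q0 ?orbT// ltW.
  have i2 : leb.-integrable setT (fun s => (defect d 0 q s)%:E).
    by apply: integrable_defect; rewrite ?q0 ?orbT// ltW.
  exact: (@integrableB _ _ _ leb _ measurableT _ _ i1 i2).
have ih2 : leb.-integrable setT (EFin \o h2).
  apply: (@integrable_itv_bounded _ 0 S (hk d t 0)).
    by apply: measurable_hk => //; exact: measurable_funD.
  by move=> s /andP[s0 _]; rewrite ger0_norm ?hk_ge0// hk_le// ?ltW// ltrDr.
have i_f : leb.-integrable setT (EFin \o f).
  apply: (@integrable_itv_bounded _ _ _ (hk d t 0)); first exact: measurable_hk.
  by move=> s /andP[/ltW s0 _]; rewrite ger0_norm ?hk_ge0// hk_le// ltW.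
have iind : leb.-integrable setT (EFin \o ind).
  apply: (@integrable_itv_bounded _ _ _ (hk d S 0)) => //.
  by move=> s _; rewrite ger0_norm ?hk_ge0.
have tail0 s : 0 <= tail s by rewrite /tail; case: ifP => // _; rewrite invr_ge0 sqr_ge0.
have tailE : (\int[leb]_s (tail s)%:E = (S^-1)%:E)%E by exact: integral_sqrV_tail.
have itail : leb.-integrable setT (EFin \o tail).
  apply/integrableP; split.
    apply/measurable_EFinP; apply: measurable_fun_ifT => //.
      exact: measurable_fun_ler.
    by apply: (measurableT_comp (@measurable_inv R)); exact: measurable_funX.
  under eq_integral => s _ do rewrite /= ger0_norm//.
  by rewrite tailE ltry.
have h2f : \int[leb]_s h2 s = \int[leb]_s f s.
  rewrite /Rintegral; congr fine; rewrite [RHS](@ge0_integral_affine R 1 t ltr01).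
  - rewrite mul1e; apply: eq_integral => s _; congr EFin; rewrite /h2 /f mul1r.
    by rewrite ltrDr lerD2r.
  - exact: measurable_int i_f.
  - by move=> s; rewrite lee_fin /f; case: ifP => // _; exact: hk_ge0.
have indE : \int[leb]_s ind s = hk d S 0 * t.
  rewrite /Rintegral /ind integral_if (_ : [set s | _] = `]S, S + t]%classic); last first.
    by apply/seteqP; split=> s /=; rewrite in_itv/=.
  rewrite integral_cst//; have /= -> := lebesgue_measure_itv `]S, (S + t)].
  by rewrite lte_fin ltrDl t0 -EFinB -EFinM/= [S + t]addrC addrK.
have h0 s : 0 < s -> 0 <= hk d s q by move=> _; exact: hk_ge0.
have iEh2 : leb.-integrable setT (EFin \o (fun s => e s + h2 s)).
  exact: (@integrableD _ _ _ leb _ measurableT (EFin \o e) (EFin \o h2) ie ih2).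
have iq : leb.-integrable setT (EFin \o (fun s => q / 4 * tail s)).
  exact: (@integrableZl _ _ _ leb _ measurableT (q / 4) (EFin \o tail) itail).
have irest : leb.-integrable setT (EFin \o (fun s => q / 4 * tail s + ind s)).
  exact: (@integrableD _ _ _ leb _ measurableT _ (EFin \o ind) iq iind).
have key : \int[leb]_s (m s + f s) <= \int[leb]_s (e s + h2 s + (q / 4 * tail s + ind s)).
  apply: le_Rintegral => //.
  - exact: (@integrableD _ _ _ leb _ measurableT (EFin \o m) (EFin \o f) im i_f).
  - exact: (@integrableD _ _ _ leb _ measurableT _ _ iEh2 irest).
  - by move=> s _; exact: growth_pointwise.
move: key; rewrite (RintegralD measurableT im i_f) (RintegralD measurableT iEh2 irest).
rewrite (RintegralD measurableT ie ih2) (RintegralD measurableT iq iind).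
rewrite (RintegralZl _ measurableT itail).
rewrite h2f indE (_ : \int[leb]_s tail s = S^-1); last by rewrite /Rintegral tailE.
have -> : \int[leb]_s e s = Psi d t q - Psi d 0 q.
  rewrite /Psi opprD addrACA subrr add0r -RintegralB//.
    by apply: integrable_defect; rewrite ?q0 ?orbT// ltW.
  by apply: integrable_defect; rewrite ?q0 ?orbT// ltW.
have := @hk0_le R d d2 S S1; move: (hk d S 0) => k kS.
have : k * t <= S^-1 * t by rewrite ler_pM2r.
move: (\int[leb]_s m s) (\int[leb]_s f s) (Psi d t q) (Psi d 0 q) => u v c g.
rewrite mulrDl [t * _]mulrC => kt key.
rewrite -(lerD2r v); apply: (le_trans key).
rewrite [leLHS]addrAC lerD2r -!addrA !lerD2l//.
Qed.

(** The potential grows by the integral of p_s over 0 < s <= t; testing against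
functions m below that integrand gives the lower bound in a form that needs
no integral of p_s itself. *)
Lemma Psi_growth t q (m : R -> R) : 0 < t -> 0 < q ->
  leb.-integrable setT (EFin \o m) ->
  (forall s, m s <= (if 0 < s <= t then hk d s q else 0)) ->
  \int[leb]_s m s <= Psi d t q - Psi d 0 q.
Proof.
move=> t0 q0 im mh; apply/ler_addgt0Pr => e e0.
pose S := Num.max (Num.max 1 t) ((q / 4 + t) / e).
have S1 : 1 <= S by rewrite !le_max lexx.
have tS : t <= S by rewrite !le_max lexx !orbT.
have eS : (q / 4 + t) / e <= S by rewrite le_max lexx orbT.
apply: (le_trans (Psi_growth_approx t0 q0 S1 tS im mh)); rewrite lerD2l.
rewrite ler_pdivrMr; first by rewrite -ler_pdivrMl// mulrC.
exact: lt_le_trans S1.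
Qed.

End potential_growth.

(** * The inequality for one pair of points *)

Section pair_bound.
Context {R : realType}.
Local Notation leb := (@lebesgue_measure R).
Variable d : nat.
Hypothesis d2 : (2 <= d)%N.
Implicit Types (s t q D : R).

Let d0 : (0 : R) < d%:R. Proof. by rewrite ltr0n (leq_trans _ d2). Qed.
Let p0 : (0 : R) < pi. Proof. exact: pi_gt0. Qed.

(** With u = T / s in [1, 2], the quotient of the two sides is at least
(u exp (- (u - 1) / 2))^(d/2) because q <= d T, and exp ((u - 1) / 2) <= u on that
range. *)
Lemma hk_ge_half T s q : 0 < T -> q <= T * d%:R -> T / 2 < s <= T -> hk d T q <= hk d s q.
Proof.
move=> T0 qT /andP[Ts sT]; have s0 : 0 < s by lra.
pose u := T / s; have u0 : 0 < u by rewrite divr_gt0.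
have u1 : 1 <= u by rewrite ler_pdivlMr// mul1r.
have u2 : u <= 2 by rewrite ler_pdivrMr//; lra.
have TE : T = u * s by rewrite /u divfK// gt_eqF.
(* from exp (- v) >= 1 - v, and (1 + 2 v) (1 - v) >= 1 for 0 <= v <= 1/2 *)
have expu : expR ((u - 1) / 2) <= u.
  have := @expR_ge1Dx R (- ((u - 1) / 2)).
  rewrite expRN; set v := (u - 1) / 2 => hv.
  have v1 : 0 < 1 - v by rewrite /v; lra.
  have ev : expR v <= (1 - v)^-1.
    by rewrite -[leLHS]invrK lef_pV2 ?posrE ?invr_gt0 ?expR_gt0.
  apply: (le_trans ev); rewrite -div1r ler_pdivrMr//.
  have -> : u = 1 + 2 * v by rewrite /v; lra.
  rewrite (_ : (1 + 2 * v) * (1 - v) = 1 + v * (1 - 2 * v)); last by ring.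
  rewrite lerDl mulr_ge0 /v//; lra.
have := p0; rewrite /hk; move: (pi : R) => P P0.
have -> : (4 * P * T) `^ (d%:R / 2) = u `^ (d%:R / 2) * (4 * P * s) `^ (d%:R / 2).
  rewrite -powRM; [congr (_ `^ _); rewrite TE; ring|exact: ltW|].
  by rewrite !mulr_ge0// ltW.
have C0 : 0 < (4 * P * s) `^ (d%:R / 2) by rewrite powR_gt0 ?mulr_gt0.
have U0 : 0 < u `^ (d%:R / 2) by rewrite powR_gt0.
rewrite invfM [X in X * _ <= _]mulrC -[leLHS]mulrA ler_pM2l ?invr_gt0//.
rewrite mulrC ler_pdivrMr//.
rewrite (_ : q / (4 * s) = q / (4 * T) + q / (4 * T) * (u - 1)); last first.
  by rewrite /u; field; rewrite !gt_eqF.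
rewrite opprD expRD -[leRHS]mulrA ler_peMr ?expR_ge0//.
rewrite expRN mulrC ler_pdivlMr ?expR_gt0// mul1r.
apply: (@le_trans _ _ (expR ((u - 1) / 2 * (d%:R / 2)))).
  rewrite ler_expR (_ : (u - 1) / 2 * (d%:R / 2) = d%:R / 4 * (u - 1)); last by field.
  rewrite ler_wpM2r ?subr_ge0// ler_pdivrMr ?mulr_gt0//.
  by rewrite (_ : d%:R / 4 * (4 * T) = T * d%:R)//; field.
rewrite expRM; apply: ge0_ler_powR; rewrite ?nnegrE ?expR_ge0//.
- by rewrite divr_ge0// ltW.
Qed.

Let C : R := ((4 * pi) `^ (d%:R / 2))^-1 * expR (- (d%:R / 4)).

Let C_ge0 : 0 <= C. Proof. by rewrite mulr_ge0 ?invr_ge0 ?powR_ge0 ?expR_ge0. Qed.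

Lemma hk_ge_tail T s q : 0 < T -> q <= T * d%:R -> T <= s -> C * s `^ (- (d%:R / 2)) <= hk d s q.
Proof.
move=> T0 qT Ts; have s0 := lt_le_trans T0 Ts.
rewrite /hk powRM ?mulr_ge0 ?(ltW p0) ?(ltW s0)// invfM powRN /C.
rewrite mulrAC; apply: ler_wpM2l.
  by rewrite mulr_ge0 ?invr_ge0 ?powR_ge0.
rewrite ler_expR lerN2 ler_pdivrMr ?mulr_gt0// (_ : d%:R / 4 * (4 * s) = s * d%:R); last by field.
by rewrite (le_trans qT)// ler_pM2r.
Qed.

Let powR_sqr_div D : 0 < D ->
  (D ^+ 2 / d%:R) `^ (d%:R / 2 - 1) = D ^+ (d - 2) / d%:R `^ (d%:R / 2 - 1).
Proof.
move=> D0; rewrite -[D ^+ 2]powR_mulrn ?ltW// -powR_inv1 ?ltW//.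
rewrite powRM ?powR_ge0// -!powRrM mulN1r powRN; congr (_ / _).
by rewrite -powR_mulrn ?ltW// natrB//; congr (_ `^ _); field.
Qed.

(** The function h is the integral of the tail bound [hk_ge_tail] from D^2 / d
to t. *)
Lemma h_dD_integral D t : 0 < D -> D ^+ 2 / d%:R <= t ->
  (\int[leb]_s (if (D ^+ 2 / d%:R < s <= t)%R then C * s `^ (- (d%:R / 2)) else 0)%:E =
   (((4 * pi) `^ (d%:R / 2))^-1 * h_dD d D t)%:E)%E.
Proof.
move=> D0 Tt; set T := D ^+ 2 / d%:R in Tt *.
have T0 : 0 < T by rewrite divr_gt0// exprn_gt0.
have TE : T `^ (d%:R / 2 - 1) = D ^+ (d - 2) / d%:R `^ (d%:R / 2 - 1).
  exact: powR_sqr_div.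
have T2 : d = 2%N -> t / T = 2 * t / D ^+ 2.
  by move=> dE; rewrite /T dE; field; rewrite gt_eqF.
move: T T0 TE T2 Tt => T T0 TE T2 Tt.
have t0 := lt_le_trans T0 Tt.
have n0 : d != 2%N -> 1 - d%:R / 2 != 0 :> R.
  apply: contra_neq => /eqP; rewrite subr_eq0 => /eqP dE.
  by apply/eqP; rewrite -(eqr_nat R); apply/eqP; lra.
pose F s : R := C * (if d == 2%N then ln s else (1 - d%:R / 2)^-1 * s `^ (1 - d%:R / 2)).
have dF s : 0 < s -> is_derive s 1 F (C * s `^ (- (d%:R / 2))).
  move=> s0; rewrite /F; have [dE|dn2] := eqVneq d 2%N.
    have h := is_deriveZ C (is_derive1_ln s0).
    apply: (is_derive_eq h); rewrite /GRing.scale/=; congr (_ * _).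
    by rewrite dE divff// powR_inv1// ltW.
  have h1 := is_deriveZ ((1 - d%:R / 2)^-1 : R) (is_derive1_powR (1 - d%:R / 2) s0).
  have h2 := is_deriveZ C h1; apply: (is_derive_eq h2).
  rewrite /GRing.scale/=; congr (_ * _); rewrite [LHS]mulrA mulVf ?n0// mul1r.
  by congr (_ `^ _); ring.
have mf : measurable_fun setT (fun s : R => C * s `^ (- (d%:R / 2))).
  by apply: measurable_funM => //; exact: measurable_powR.
rewrite integral_if (_ : [set s | _] = `]T, t]%classic); last first.
  by apply/seteqP; split=> s /=; rewrite in_itv/=.
rewrite integral_itv_obnd_cbnd; last first.
  by apply/measurable_EFinP; exact: measurable_funTS.
transitivity (F t - F T)%:E.
  apply: (@integral_itvcc_derive R (fun s => C * s `^ (- (d%:R / 2))) F T t Tt).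
    by move=> x /andP[Tx _]; apply: dF; exact: lt_le_trans Tx.
  move=> x /andP[Tx _].
  apply: cvgM; first exact: cvg_cst.
  exact: (is_derive_continuous (is_derive1_powR _ (lt_le_trans T0 Tx))).
congr EFin; rewrite /F /h_dD /C; case: ifPn => [/eqP dE|dn2].
  rewrite -mulrBr -[LHS]mulrA dE; congr (_ * (expR _ * _)); first by field.
  by rewrite -ln_div ?posrE// T2.
have NE s : s `^ (1 - d%:R / 2) = (s `^ (d%:R / 2 - 1))^-1.
  by rewrite -powRN opprB.
rewrite !NE TE invf_div -!mulrBr -[LHS]mulrA; congr (_ * _).
by rewrite mulrA.
Qed.

Lemma Psi_growth_ge D t q : 0 < D -> 0 < q <= D ^+ 2 -> D ^+ 2 / d%:R <= t ->
  hk d (D ^+ 2 / d%:R) q * (D ^+ 2 / d%:R / 2) +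
    ((4 * pi) `^ (d%:R / 2))^-1 * h_dD d D t <= Psi d t q - Psi d 0 q.
Proof.
move=> D0 /andP[q0 qD] Tt; have hI := h_dD_integral D0 Tt.
set T := D ^+ 2 / d%:R in Tt hI *.
have T0 : 0 < T by rewrite divr_gt0// exprn_gt0.
have t0 := lt_le_trans T0 Tt.
have qT : q <= T * d%:R by rewrite divfK// gt_eqF.
pose m1 s := if T / 2 < s <= T then hk d T q else 0.
pose m2 s := if T < s <= t then C * s `^ (- (d%:R / 2)) else 0.
have m20 s : 0 <= m2 s by rewrite /m2; case: ifP => // _; rewrite mulr_ge0 ?powR_ge0.
have i1 : leb.-integrable setT (EFin \o m1).
  apply: (@integrable_itv_bounded _ (fun=> hk d T q) _ _ (hk d T q)) => //.
  by move=> s _; rewrite ger0_norm ?hk_ge0.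
have i2 : leb.-integrable setT (EFin \o m2).
  apply/integrableP; split.
    apply/measurable_EFinP; apply: measurable_fun_ifT => //.
      by apply: measurable_and; [apply: measurable_fun_ltr|apply: measurable_fun_ler].
    by apply: measurable_funM => //; exact: measurable_powR.
  under eq_integral => s _ do rewrite /= ger0_norm//.
  by rewrite hI ltry.
have i12 : leb.-integrable setT (EFin \o (fun s => m1 s + m2 s)).
  exact: (@integrableD _ _ _ leb _ measurableT (EFin \o m1) (EFin \o m2) i1 i2).
have m1E : \int[leb]_s m1 s = hk d T q * (T / 2).
  rewrite /Rintegral /m1 integral_if (_ : [set s | _] = `]T / 2, T]%classic); last first.
    by apply/seteqP; split=> s /=; rewrite in_itv/=.
  rewrite integral_cst//; have /= -> := lebesgue_measure_itv `](T / 2), T].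
  rewrite lte_fin (_ : T / 2 < T); last by rewrite ltr_pdivrMr// ltr_pMr// ltr1n.
  by rewrite -EFinB -EFinM/=; congr (_ * _); rewrite [X in X - _]splitr addrK.
have m2E : \int[leb]_s m2 s = ((4 * pi) `^ (d%:R / 2))^-1 * h_dD d D t.
  by rewrite /Rintegral hI.
rewrite -m1E -m2E -RintegralD//; apply: Psi_growth => // s.
have hk0 := hk_ge0 d s q.
rewrite /m1 /m2; have [sT|Ts] /= := leP s T.
  rewrite addr0 andbT; case: ifP => Ts; last first.
    by case: ifP.
  have s0 : 0 < s by rewrite (lt_trans _ Ts)// divr_gt0.
  have st : s <= t by rewrite (le_trans sT).
  rewrite s0 st /=.
  by apply: hk_ge_half => //; rewrite Ts.
rewrite andbF add0r (lt_trans T0 Ts)/=.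
by case: ifP => // _; apply: (hk_ge_tail T0) => //; exact: ltW.
Qed.

(** With T = D^2 / d, the prefactor is (4 pi T)^(d/2) / (T / 2), so that it turns
(T / 2) p_T into exp (- q / (4 T)), and 1 / (4 T) = (sqrt d / (2 D))^2 <= a^2. *)
Lemma gaussian_le_Psi_growth D t a q : 0 < D -> 0 < q <= D ^+ 2 -> D ^+ 2 / d%:R <= t ->
  Num.sqrt d%:R / (2 * D) <= a ->
  expR (- (a ^+ 2 * q)) <=
  2 * (4 * pi) `^ (d%:R / 2) * D ^+ (d - 2) / d%:R `^ (d%:R / 2 - 1) *
  (Psi d t q - Psi d 0 q - ((4 * pi) `^ (d%:R / 2))^-1 * h_dD d D t).
Proof.
move=> D0 qD Tt ha; have hP := Psi_growth_ge D0 qD Tt.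
have /andP[q0 _] := qD.
have P0 : 0 < (4 * pi : R) `^ (d%:R / 2) by rewrite powR_gt0 ?mulr_gt0.
have N0 : 0 < d%:R `^ (d%:R / 2 - 1) :> R by rewrite powR_gt0.
have K0 : 0 < 2 * (4 * pi) `^ (d%:R / 2) * D ^+ (d - 2) / d%:R `^ (d%:R / 2 - 1).
  by rewrite !mulr_gt0 ?invr_gt0 ?exprn_gt0.
apply: (@le_trans _ _ (2 * (4 * pi) `^ (d%:R / 2) * D ^+ (d - 2) / d%:R `^ (d%:R / 2 - 1) *
   (hk d (D ^+ 2 / d%:R) q * (D ^+ 2 / d%:R / 2)))); last first.
  by rewrite ler_pM2l// lerBrDr.
set T := D ^+ 2 / d%:R.
have T0 : 0 < T by rewrite divr_gt0// exprn_gt0.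
have TE : T `^ (d%:R / 2) = T * (D ^+ (d - 2) / d%:R `^ (d%:R / 2 - 1)).
  rewrite -[in LHS](subrK 1 (d%:R / 2)) powRD ?powRr1 ?(ltW T0)//; last first.
    by apply/implyP => _; rewrite gt_eqF.
  by rewrite mulrC powR_sqr_div.
have pT : (4 * pi * T) `^ (d%:R / 2) = (4 * pi) `^ (d%:R / 2) * T `^ (d%:R / 2).
  by rewrite powRM ?(ltW T0)// mulr_ge0// ltW.
rewrite /hk pT TE.
have DD0 : 0 < D ^+ (d - 2) by rewrite exprn_gt0.
rewrite [leRHS](_ : _ = expR (- (q / (4 * T)))); last first.
  by field; rewrite !gt_eqF.
rewrite ler_expR lerN2 [leRHS]mulrC; apply: ler_wpM2l; first exact: ltW.
rewrite (_ : (4 * T)^-1 = (Num.sqrt d%:R / (2 * D)) ^+ 2); last first.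
  by rewrite exprMn sqr_sqrtr ?ltW// /T; field; rewrite !gt_eqF.
have b0 : 0 <= Num.sqrt d%:R / (2 * D).
  by rewrite divr_ge0 ?sqrtr_ge0// mulr_ge0// ltW.
by rewrite ler_sqr// nnegrE (le_trans b0).
Qed.

End pair_bound.

(** * The theorem *)

Section diameter.
Context {R : realType} (d : nat).
Variable Omega : set 'rV[R]_d.
Hypothesis bO : bounded_set Omega.

Lemma normr_coord_le (v : 'rV[R]_d) i : `|v 0 i| <= `|v|.
Proof.
rewrite [leRHS]/Num.norm/= mx_normrE.
exact: (le_bigmax _ (fun ij : 'I_1 * 'I_d => `|v ij.1 ij.2|) (0, i)).
Qed.

Lemma enorm_le_diam (x y : 'rV[R]_d) : Omega x -> Omega y -> enorm (x - y) <= diam Omega.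
Proof.
move=> Ox Oy; apply: ub_le_sup; last by exists (x, y).
have [M [_ /(_ (M + 1))]] := bO; rewrite ltrDl ltr01 => /(_ isT) hM.
exists (Num.sqrt (\sum_(i < d) (2 * (M + 1)) ^+ 2)) => _ [[u v] [/= /hM Mu /hM Mv] <-].
rewrite ler_wsqrtr// ler_sum// => i _; rewrite !mxE -[leLHS]real_normK ?num_real//.
rewrite ler_sqr ?nnegrE//; last first.
  by rewrite mulr_ge0// (le_trans _ Mu)// normr_ge0.
apply: (le_trans (ler_normB _ _)); rewrite mulr_natl mulr2n lerD//.
  exact: (le_trans (normr_coord_le u i)).
exact: (le_trans (normr_coord_le v i)).
Qed.

Lemma diam_gt0 : (0 < d)%N -> interior Omega !=set0 -> 0 < diam Omega.
Proof.
move=> d0 [p Op].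
have [e /= e0 he] := (nbhs_ballP p Omega).1 Op.
have Op' : Omega p by apply: he; exact: ballxx.
pose v : 'rV[R]_d := const_mx (e / 2).
have Opv : Omega (p + v).
  apply: he; rewrite -ball_normE/= opprD addNKr normrN.
  rewrite [X in X < _]/Num.norm/= mx_normrE; apply: bigmax_lt => // -[k i] _ /=.
  by rewrite mxE ger0_norm ?divr_ge0 ?(ltW e0)// ltr_pdivrMr// ltr_pMr// ltr1n.
apply: (@lt_le_trans _ _ (enorm (p + v - p))); last exact: enorm_le_diam.
rewrite addrC addKr lt_neqAle enorm_ge0 andbT eq_sym enorm_eq0.
apply/eqP => /rowP /(_ (Ordinal d0)); rewrite !mxE => /eqP.
by rewrite gt_eqF// divr_gt0.
Qed.

End diameter.

Lemma sum_offdiag (V : zmodType) n (F : 'I_n -> 'I_n -> V) :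
  \sum_(i < n) \sum_(j < n | i != j) F i j =
  \sum_(i < n) \sum_(j < n) F i j - \sum_(i < n) F i i.
Proof.
rewrite -sumrB; apply: eq_bigr => i _; rewrite [X in _ = X - _](bigD1 i)//= [RHS]addrC addKr.
by apply: eq_bigl => j; rewrite eq_sym.
Qed.

Theorem theorem4p6 (R : realType) (d : nat) (hd : (2 <= d)%N)
    (Omega : set 'rV[R]_d) (Omega_bounded : bounded_set Omega)
    (Omega_interior : interior Omega !=set0)
    (N : nat) (hN : (0 < N)%N) (x : 'I_N -> 'rV[R]_d)
    (x_inj : injective x) (x_Omega : forall i, Omega (x i)) :
  let D := diam Omega in
  forall t a : R,
    D ^+ 2 / d%:R <= t ->
    Num.sqrt d%:R / (2 * D) <= a ->
    (N%:R ^+ 2)^-1 * (\sum_(i < N) \sum_(j < N | i != j)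
        expR (- (a ^+ 2 * enorm (x i - x j) ^+ 2)))
    <= 2 * (4 * pi) `^ (d%:R / 2) * D ^+ (d - 2) / d%:R `^ (d%:R / 2 - 1) *
       (- ((N%:R ^+ 2)^-1 * (\sum_(i < N) \sum_(j < N | i != j)
             fund_sol (x i) (x j)))
        + A_d x t
        - C_d d t / N%:R
        - ((4 * pi) `^ (d%:R / 2))^-1 * ((N%:R - 1) / N%:R) * h_dD d D t).
Proof.
move=> D t a Dt Da.
have d0 : (0 : R) < d%:R by rewrite ltr0n (leq_trans _ hd).
have D0 : 0 < D by apply: diam_gt0 => //; exact: leq_trans hd.
have t0 : 0 < t by rewrite (lt_le_trans _ Dt)// divr_gt0// exprn_gt0.
have NN : N%:R != 0 :> R by rewrite pnatr_eq0 -lt0n.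
rewrite A_dE// C_dE//.
set K := _ / _ `^ _; set c := ((4 * pi) `^ _)^-1; set h := h_dD d D t.
have pair i j : i != j -> expR (- (a ^+ 2 * enorm (x i - x j) ^+ 2)) <=
    K * (Psi d t (sqn (x i - x j)) - fund_sol (x i) (x j) - c * h).
  move=> ij; have q0 : 0 < enorm (x i - x j).
    rewrite lt_neqAle enorm_ge0 andbT eq_sym enorm_eq0 subr_eq0.
    by apply: contra_neq ij => /x_inj.
  rewrite -sqr_enorm fund_solE -(Psi0E hd q0).
  apply: gaussian_le_Psi_growth => //; rewrite exprn_gt0//= ler_sqr ?nnegrE ?enorm_ge0 ?(ltW D0)//.
  exact: enorm_le_diam.
apply: (@le_trans _ _ ((N%:R ^+ 2)^-1 * (\sum_(i < N) \sum_(j < N | i != j)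
    (K * (Psi d t (sqn (x i - x j)) - fund_sol (x i) (x j) - c * h))))).
  rewrite ler_wpM2l ?invr_ge0 ?sqr_ge0//.
  by apply: ler_sum => i _; apply: ler_sum => j; exact: pair.
rewrite le_eqVlt; apply/orP; left; apply/eqP.
have E : \sum_(i < N) \sum_(j < N | i != j)
      K * (Psi d t (sqn (x i - x j)) - fund_sol (x i) (x j) - c * h) =
    K * (\sum_(i < N) \sum_(j < N) Psi d t (sqn (x i - x j)) - N%:R * Psi d t 0 -
      \sum_(i < N) \sum_(j < N | i != j) fund_sol (x i) (x j) -
      (N%:R * N%:R - N%:R) * (c * h)).
  under eq_bigr do rewrite -mulr_sumr; rewrite -mulr_sumr; congr (_ * _).
  under eq_bigr do rewrite !sumrB; rewrite !sumrB.
  congr (_ - _ - _).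
    rewrite sum_offdiag; congr (_ - _).
    under eq_bigr do rewrite subrr sqn0.
    by rewrite sumr_const card_ord mulr_natl.
  rewrite (sum_offdiag (fun _ _ => c * h)) !sumr_const card_ord.
  by rewrite mulrBl -mulrA !mulr_natl.
rewrite E mulrCA; congr (_ * _).
move: (\sum_(i < N) \sum_(j < N) Psi d t _) (\sum_(i < N) \sum_(j < N | i != j) fund_sol _ _).
move=> P G; field.
by [].
Qed.
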